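(* Let $p\neq2$. The functor $C:\mathsf{ComRings}\to\mathsf{Ab}$ is a universal weak pre-Witt functor. In particular, there is a natural transformation $\eta:C\to E$ compatible with $V$ and $\langle\ \rangle$.
   Context: $p$ is an odd prime. Definition of $C$: for a ring $R$, $\tilde G(R)$ is the free abelian group on symbols $V^n_r$ ($n\in\mathbb N_0$, $0\ne r\in R$), $V^n_0:=0$, $V(V^n_r)=V^{n+1}_r$, $\langle r\rangle=V^0_r$; $H(R)$ is generated by $(V^n_{(x+y)^p}-pV^{n-1}_{x+y})-(V^n_{x^p}-pV^{n-1}_x)-(V^n_{y^p}-pV^{n-1}_y)$ ($x,y\in R$, $n\ge1$) and $V^n_r+V^n_{-r}$; $\tilde H(R)$ is its $p$-saturation; $G^0(R)$ is the $V$-adic completion of $\tilde G(R)/\tilde H(R)$; $G(R)$ is $G^0(R)$ modulo the closed subgroup generated by $p$-power torsion. For commutative $R$ with $0\to I\to\mathbb Z[R]\to R\to0$ ($\mathbb Z[R]$ polynomial ring on the set $R$), $C(R)=G(\mathbb Z[R])/G_I(\mathbb Z[R])$, $G_I$ the closed subgroup generated by $V^n_x-V^n_y$, $x-y\in I$. Definition of $E$: for commutative $B$, $X(B)$ is the closed subgroup of $B^{\mathbb N_0}$ (product topology) generated by $V^n\langle b\rangle$, where $V(b_0,b_1,\dots)=p(0,b_0,b_1,\dots)$, $\langle b\rangle=(b,b^p,b^{p^2},\dots)$; $E(R)=X(\mathbb Z[R])/X_I(\mathbb Z[R])$, $X_I$ the closed subgroup generated by $V^n\langle a\rangle-V^n\langle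 b\rangle$ with $a-b\in I$, and $\langle x\rangle\in E(R)$ is the class of $\langle [x]\rangle$. A weak pre-Witt functor is a functor $F:\mathsf{ComRings}\to\mathsf{Ab}$ with functorial group endomorphisms $V$ and functorial set maps $\langle\ \rangle:R\to F(R)$ such that: (1) $\langle0\rangle=0$ and $\langle-x\rangle=-\langle x\rangle$; (2) $x\mapsto V\langle x^p\rangle-p\langle x\rangle$ is additive; (3) $F(R)$ is complete with respect to $\{V^nF(R)\}$; (4') if $A$ is a polynomial ring over $\mathbb Z$ then $F(A)$ is $p$-torsion free. Universal means that for every weak pre-Witt functor $F$ there is a natural transformation $C\to F$ compatible with $V$ and $\langle\ \rangle$ (initial object). $E$ is a weak pre-Witt functor. *)

(* Defs.v *)
From HB Require Import structures.
From mathcomp Require Import all_boot all_algebra ring_quotient generic_quotient.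
From mathcomp Require Import boolp functions finmap.
From mathcomp.multinomials Require Import monalg.
Set Implicit Arguments. Unset Strict Implicit. Unset Printing Implicit Defensive.
Import GRing.Theory.
Local Open Scope ring_scope.
Local Open Scope quotient_scope.

Record subgroup (M : zmodType) := Subgroup {
  sg_mem :> M -> Prop;
  sg0 : sg_mem 0;
  sgB : forall x y, sg_mem x -> sg_mem y -> sg_mem (x - y) }.

Definition sgp (M : zmodType) (S : subgroup M) : {pred M} := fun x => `[< S x >].

Lemma sgp_zmod (M : zmodType) (S : subgroup M) : zmod_closed (sgp S).
Proof.
split; first by rewrite unfold_in; apply/asboolP; exact: sg0.
by move=> x y; rewrite !unfold_in => /asboolP hx /asboolP hy; apply/asboolP; exact: sgB.
Qed.
HB.instance Definition _ (M : zmodType) (S : subgroup M) :=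
  GRing.isZmodClosed.Build M (sgp S) (sgp_zmod S).

Definition quotg (M : zmodType) (S : subgroup M) : zmodType := Quotient.quot (sgp S).

Record subT (M : zmodType) (S : subgroup M) := SubT {
  subT_val :> M; _ : subT_val \in sgp S }.
HB.instance Definition _ (M : zmodType) (S : subgroup M) := [isSub for @subT_val M S].
HB.instance Definition _ (M : zmodType) (S : subgroup M) := [Choice of subT S by <:].
HB.instance Definition _ (M : zmodType) (S : subgroup M) :=
  [SubChoice_isSubZmodule of subT S by <:].

Section Gen.
Variable M : zmodType.
Implicit Types (S : subgroup M).

Lemma sgN S x : S x -> S (- x).
Proof. by move=> Sx; rewrite -sub0r; apply: sgB => //; exact: sg0. Qed.

Lemma sgD S x y : S x -> S y -> S (x + y).
Proof. by move=> Sx Sy; rewrite -[y]opprK; apply: sgB => //; exact: sgN. Qed.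

Lemma sgMn S x n : S x -> S (x *+ n).
Proof. by move=> Sx; elim: n => [|n IH]; [rewrite mulr0n; exact: sg0|rewrite mulrS; exact: sgD]. Qed.

Inductive gen (P : M -> Prop) : M -> Prop :=
  | gen_0 : gen P 0
  | gen_in x : P x -> gen P x
  | gen_B x y : gen P x -> gen P y -> gen P (x - y).

Definition genS (P : M -> Prop) : subgroup M := Subgroup (gen_0 P) (@gen_B P).

Definition sat_pred (p : nat) S (x : M) : Prop := exists k, S (x *+ (p ^ k)).

Lemma sat0 p S : sat_pred p S 0.
Proof. by exists 0%N; rewrite mul0rn; exact: sg0. Qed.

Lemma satB p S x y : sat_pred p S x -> sat_pred p S y -> sat_pred p S (x - y).
Proof.
move=> [a Ha] [b Hb]; exists (a + b)%N; rewrite mulrnBl expnD.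
by apply: sgB; [rewrite mulrnA; exact: sgMn | rewrite mulnC mulrnA; exact: sgMn].
Qed.

Definition saturation p S : subgroup M := Subgroup (sat0 p S) (@satB p S).

(* closure of a subgroup for the topology whose neighbourhoods of 0 are the U n *)
Definition cl_pred (U : nat -> subgroup M) S (x : M) : Prop :=
  forall n, exists2 s, S s & U n (x - s).

Lemma cl0 U S : cl_pred U S 0.
Proof. by move=> n; exists 0; [exact: sg0 | rewrite subr0; exact: sg0]. Qed.

Lemma clB U S x y : cl_pred U S x -> cl_pred U S y -> cl_pred U S (x - y).
Proof.
move=> hx hy n; have [s Ss Us] := hx n; have [t St Ut] := hy n.
exists (s - t); first exact: sgB.
have -> : x - y - (s - t) = (x - s) - (y - t).
  by rewrite !opprB addrACA [RHS]addrACA (addrC (- y)).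
exact: sgB.
Qed.

Definition closure (U : nat -> subgroup M) S : subgroup M :=
  Subgroup (cl0 U S) (@clB U S).

Definition qimg_pred (N S : subgroup M) (q : quotg N) : Prop :=
  exists2 x, S x & q = \pi_(quotg N) x.
Arguments qimg_pred : clear implicits.

Lemma qimg0 N S : qimg_pred N S 0.
Proof. by exists 0; [exact: sg0 | rewrite raddf0]. Qed.

Lemma qimgB N S q r : qimg_pred N S q -> qimg_pred N S r -> qimg_pred N S (q - r).
Proof.
by move=> [x Sx ->] [y Sy ->]; exists (x - y); [exact: sgB | rewrite raddfB].
Qed.

Definition qimg (N S : subgroup M) : subgroup (quotg N) :=
  Subgroup (qimg0 N S) (@qimgB N S).

Definition qlift (M' : zmodType) (N : subgroup M) (N' : subgroup M') (f : M -> M')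
  (q : quotg N) : quotg N' := \pi_(quotg N') (f (repr q)).
End Gen.


Section Completion.
Variables (M : zmodType) (U : nat -> subgroup M).

Definition cauchy_pred (x : nat -> M) : Prop := forall n, U n (x n.+1 - x n).

Lemma cauchy0 : cauchy_pred 0.
Proof. by move=> n; rewrite /= subr0; exact: sg0. Qed.

Lemma cauchyB x y : cauchy_pred x -> cauchy_pred y -> cauchy_pred (x - y).
Proof.
move=> hx hy n /=.
have -> : x n.+1 - y n.+1 - (x n - y n) = (x n.+1 - x n) - (y n.+1 - y n).
  by rewrite !opprB addrACA [RHS]addrACA (addrC (- y n.+1)).
exact: sgB.
Qed.

Definition cauchy : subgroup (nat -> M) := Subgroup cauchy0 cauchyB.

Definition CS := subT cauchy.

Definition fil_pred (n : nat) (x : CS) : Prop := U n (subT_val x n).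

Lemma fil0 n : fil_pred n 0.
Proof. exact: sg0. Qed.

Lemma filB n x y : fil_pred n x -> fil_pred n y -> fil_pred n (x - y).
Proof. exact: sgB. Qed.

Definition filS n : subgroup CS := Subgroup (fil0 n) (@filB n).

Definition null_pred (x : CS) : Prop := forall n, fil_pred n x.

Lemma null0 : null_pred 0. Proof. by move=> n; exact: fil0. Qed.
Lemma nullB x y : null_pred x -> null_pred y -> null_pred (x - y).
Proof. by move=> hx hy n; apply: filB. Qed.

Definition null : subgroup CS := Subgroup null0 nullB.

(* the completion  lim_n M / U n *)
Definition completion : zmodType := quotg null.

(* its canonical neighbourhoods of 0 (kernels of completion -> M / U n) *)
Definition compl_nbhd (n : nat) : subgroup completion := qimg null (filS n).

Definition compl_embed (m : M) : completion :=
  \pi_completion (insubd (0 : CS) (fun _ : nat => m)).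
End Completion.

Definition compl_lift (M M' : zmodType) (U : nat -> subgroup M) (U' : nat -> subgroup M')
  (f : M -> M') (c : completion U) : completion U' :=
  \pi_(completion U') (insubd (0 : CS U') (fun n => f (subT_val (repr c) n))).

Arguments qlift {M M'} N N' f q.
Arguments compl_lift {M M'} U U' f c.
Arguments compl_nbhd {M} U n.
Arguments compl_embed {M} U m.
Arguments qimg {M} N S.
Arguments closure {M} U S.
Arguments genS {M} P.
Arguments saturation {M} p S.

Section Witt.
Variable p : nat.

(* symbols V^n_r with r <> 0 *)
Definition Sym (A : comPzRingType) := (nat * {r : A | r != 0})%type.

Definition Gt (A : comPzRingType) : zmodType := {malg int[Sym A]}.

Definition sym (A : comPzRingType) (n : nat) (r : A) : Gt A :=
  match insub r : option {r : A | r != 0} with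
  | Some r' => << ((n, r') : Sym A) >>
  | None => 0
  end.

Definition Vt (A : comPzRingType) (g : Gt A) : Gt A :=
  \sum_(k <- msupp g) << g@_k *g ((k.1.+1, k.2) : Sym A) >>.

Definition hrel (A : comPzRingType) (n : nat) (x y : A) : Gt A :=
  (sym n ((x + y) ^+ p) - sym n.-1 (x + y) *+ p)
  - (sym n (x ^+ p) - sym n.-1 x *+ p)
  - (sym n (y ^+ p) - sym n.-1 y *+ p).

Definition Hgen (A : comPzRingType) (g : Gt A) : Prop :=
  (exists n x y, (0 < n)%N /\ g = hrel n x y)
  \/ (exists n r, g = sym n r + sym n (- r)).

Definition H (A : comPzRingType) : subgroup (Gt A) := genS (@Hgen A).
Definition Ht (A : comPzRingType) : subgroup (Gt A) := saturation p (H A).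

(* V^n tilde G(A) *)
Definition Fil (A : comPzRingType) (n : nat) : subgroup (Gt A) :=
  genS (fun g => exists m r, (n <= m)%N /\ g = sym m r).

Definition Q1 (A : comPzRingType) : zmodType := quotg (Ht A).
Definition U1 (A : comPzRingType) (n : nat) : subgroup (Q1 A) := qimg (Ht A) (Fil A n).

Definition G0 (A : comPzRingType) : zmodType := completion (U1 A).
Definition W0 (A : comPzRingType) (n : nat) : subgroup (G0 A) := compl_nbhd (U1 A) n.

Definition ptors_pred (M : zmodType) (x : M) : Prop := exists k, x *+ (p ^ k) = 0.

Definition Tcl (A : comPzRingType) : subgroup (G0 A) :=
  closure (W0 A) (genS (@ptors_pred (G0 A))).

Definition G (A : comPzRingType) : zmodType := quotg (Tcl A).
Definition WG (A : comPzRingType) (n : nat) : subgroup (G A) := qimg (Tcl A) (W0 A n).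

Definition toG (A : comPzRingType) (g : Gt A) : G A :=
  \pi_(G A) (compl_embed (U1 A) (\pi_(Q1 A) g)).

Definition VG (A : comPzRingType) : G A -> G A :=
  qlift (Tcl A) (Tcl A) (compl_lift (U1 A) (U1 A) (qlift (Ht A) (Ht A) (@Vt A))).

Definition Gtmap (A B : comPzRingType) (phi : A -> B) (g : Gt A) : Gt B :=
  \sum_(k <- msupp g) sym k.1 (phi (val k.2)) *~ g@_k.

Definition Gmap (A B : comPzRingType) (phi : A -> B) : G A -> G B :=
  qlift (Tcl A) (Tcl B) (compl_lift (U1 A) (U1 B) (qlift (Ht A) (Ht B) (Gtmap phi))).

(* Z[R]: the polynomial ring over Z on the set R *)
Definition ZR (R : comPzRingType) : comPzRingType := {malg int[{cmonom R}]}.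
Definition varZ (R : comPzRingType) (x : R) : ZR R := << ucm x >>.
Definition evalZ (R : comPzRingType) (a : ZR R) : R :=
  \sum_(m <- msupp a) (a@_m)%:~R * \prod_(r <- finsupp m) r ^+ (m r).
Definition Zmap (R S : comPzRingType) (f : R -> S) (a : ZR R) : ZR S :=
  \sum_(m <- msupp a) (\prod_(r <- finsupp m) varZ (f r) ^+ (m r)) *~ a@_m.
End Witt.

Arguments Tcl p A.
Arguments G p A.
Arguments WG p A n.
Arguments toG p {A} g.
Arguments VG p {A} _.
Arguments Gmap p {A B} phi _.

Section CE.
Variable p : nat.

Definition GIgen (R : comPzRingType) (g : G p (ZR R)) : Prop :=
  exists n (x y : ZR R), evalZ (x - y) = 0 /\ g = toG p (sym n x - sym n y).

Definition GI (R : comPzRingType) : subgroup (G p (ZR R)) :=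
  closure (WG p (ZR R)) (genS (@GIgen R)).

Definition C (R : comPzRingType) : zmodType := quotg (GI R).
Definition C_V (R : comPzRingType) : C R -> C R := qlift (GI R) (GI R) (VG p).
Definition C_br (R : comPzRingType) (x : R) : C R :=
  \pi_(C R) (toG p (sym 0 (varZ x))).
Definition C_map (R S : comPzRingType) (f : R -> S) : C R -> C S :=
  qlift (GI R) (GI S) (Gmap p (Zmap f)).

Definition VE (B : comPzRingType) (b : nat -> B) : nat -> B :=
  fun k => if k is k'.+1 then b k' *+ p else 0.
Definition ang (B : comPzRingType) (b : B) : nat -> B := fun k => b ^+ (p ^ k).

(* neighbourhoods of 0 for the product topology on B^N (B discrete) *)
Definition Uprod_pred (B : comPzRingType) (N : nat) (x : nat -> B) : Prop :=
  forall k, (k < N)%N -> x k = 0.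
Lemma Uprod0 (B : comPzRingType) N : @Uprod_pred B N 0.
Proof. by []. Qed.
Lemma UprodB (B : comPzRingType) N x y :
  @Uprod_pred B N x -> Uprod_pred N y -> Uprod_pred N (x - y).
Proof. by move=> hx hy k hk; rewrite /GRing.add /GRing.opp /=; rewrite hx // hy // subr0. Qed.
Definition Uprod (B : comPzRingType) (N : nat) : subgroup (nat -> B) :=
  Subgroup (@Uprod0 B N) (@UprodB B N).

Definition Xset (B : comPzRingType) : subgroup (nat -> B) :=
  closure (@Uprod B) (genS (fun x => exists n (b : B), x = iter n (@VE B) (ang b))).

Definition X (B : comPzRingType) : zmodType := subT (Xset B).

Definition UX_pred (B : comPzRingType) (N : nat) (x : X B) : Prop := @Uprod B N (subT_val x).
Lemma UX0 (B : comPzRingType) N : @UX_pred B N 0.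
Proof. exact: sg0. Qed.
Lemma UXB (B : comPzRingType) N x y :
  @UX_pred B N x -> UX_pred N y -> UX_pred N (x - y).
Proof. exact: sgB. Qed.
Definition UX (B : comPzRingType) (N : nat) : subgroup (X B) :=
  Subgroup (@UX0 B N) (@UXB B N).

Definition XI (R : comPzRingType) : subgroup (X (ZR R)) :=
  closure (@UX (ZR R)) (genS (fun x => exists n (a b : ZR R), evalZ (a - b) = 0 /\
     subT_val x = iter n (@VE _) (ang a) - iter n (@VE _) (ang b))).

Definition E (R : comPzRingType) : zmodType := quotg (XI R).
Definition E_V (R : comPzRingType) (e : E R) : E R :=
  \pi_(E R) (insubd (0 : X (ZR R)) (VE (subT_val (repr e)))).
Definition E_br (R : comPzRingType) (x : R) : E R :=
  \pi_(E R) (insubd (0 : X (ZR R)) (ang (varZ x))).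
Definition E_map (R S : comPzRingType) (f : R -> S) (e : E R) : E S :=
  \pi_(E S) (insubd (0 : X (ZR S)) (fun k => Zmap f (subT_val (repr e) k))).
End CE.
Arguments C_map p {R S} f _.
Arguments E_map p {R S} f _.
Arguments C_V p {R} _.
Arguments E_V p {R} _.
Arguments C_br p {R} _.
Arguments E_br p {R} _.

Record PWdata := PWD {
  Fo : comPzRingType -> zmodType;
  Fmap : forall R S : comPzRingType, {rmorphism R -> S} -> Fo R -> Fo S;
  FV : forall R : comPzRingType, Fo R -> Fo R;
  Fbr : forall R : comPzRingType, R -> Fo R }.
Arguments Fo _ _.
Arguments Fmap _ {R S} _ _.
Arguments FV _ {R} _.
Arguments Fbr _ {R} _.

Definition is_functor (D : PWdata) : Prop :=
  [/\ (forall (R S : comPzRingType) (f : {rmorphism R -> S}) (a b : Fo D R),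
         Fmap D f (a - b) = Fmap D f a - Fmap D f b),
      (forall (R : comPzRingType) (f : {rmorphism R -> R}),
         (forall x, f x = x) -> forall a : Fo D R, Fmap D f a = a),
      (forall (R S T : comPzRingType) (f : {rmorphism R -> S}) (g : {rmorphism S -> T})
         (h : {rmorphism R -> T}), (forall x, h x = g (f x)) ->
         forall a : Fo D R, Fmap D h a = Fmap D g (Fmap D f a)),
      (forall (R : comPzRingType) (a b : Fo D R), FV D (a - b) = FV D a - FV D b) &
   [/\ (forall (R S : comPzRingType) (f : {rmorphism R -> S}) (a : Fo D R),
         Fmap D f (FV D a) = FV D (Fmap D f a)) &
      (forall (R S : comPzRingType) (f : {rmorphism R -> S}) (x : R),
         Fmap D f (Fbr D x) = Fbr D (f x))]].

Definition inVn (D : PWdata) (R : comPzRingType) (n : nat) (a : Fo D R) : Prop :=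
  exists b, a = iter n (FV D (R:=R)) b.

Definition Vcomplete (D : PWdata) (R : comPzRingType) : Prop :=
  (forall a : Fo D R, (forall n, inVn n a) -> a = 0) /\
  (forall s : nat -> Fo D R, (forall n, inVn n (s n.+1 - s n)) ->
     exists a, forall n, inVn n (a - s n)).

Definition is_weak_pre_Witt (p : nat) (D : PWdata) : Prop :=
  [/\ is_functor D,
      (forall R : comPzRingType, Fbr D (0 : R) = 0 /\ forall x : R, Fbr D (- x) = - Fbr D x),
      (forall (R : comPzRingType) (x y : R),
         FV D (Fbr D ((x + y) ^+ p)) - Fbr D (x + y) *+ p
         = (FV D (Fbr D (x ^+ p)) - Fbr D x *+ p) + (FV D (Fbr D (y ^+ p)) - Fbr D y *+ p)),
      (forall R : comPzRingType, Vcomplete D R) &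
      (forall (Xv : choiceType) (A : comPzRingType)
         (phi : {rmorphism {malg int[{cmonom Xv}]} -> A}), bijective phi ->
         forall a : Fo D A, a *+ p = 0 -> a = 0)].

Definition compatible_nt (D1 D2 : PWdata) (eta : forall R, Fo D1 R -> Fo D2 R) : Prop :=
  [/\ (forall (R : comPzRingType) (a b : Fo D1 R), eta R (a - b) = eta R a - eta R b),
      (forall (R S : comPzRingType) (f : {rmorphism R -> S}) (a : Fo D1 R),
         eta S (Fmap D1 f a) = Fmap D2 f (eta R a)),
      (forall (R : comPzRingType) (a : Fo D1 R), eta R (FV D1 a) = FV D2 (eta R a)) &
      (forall (R : comPzRingType) (x : R), eta R (Fbr D1 x) = Fbr D2 x)].
Arguments compatible_nt : clear implicits.

Definition Cfun (p : nat) : PWdata :=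
  @PWD (C p) (fun R S f => C_map p (fun x => f x)) (@C_V p) (@C_br p).
Definition Efun (p : nat) : PWdata :=
  @PWD (E p) (fun R S f => E_map p (fun x => f x)) (@E_V p) (@E_br p).

(* Main.v *)
Require Import Defs.
From HB Require Import structures.
From mathcomp Require Import all_boot all_order all_algebra.
From mathcomp Require Import ring_quotient generic_quotient boolp functions finmap.
From mathcomp.multinomials Require Import monalg.
(* [all_boot] rebinds [closure] and other names of [Defs]. *)
Import Defs.
Set Implicit Arguments. Unset Strict Implicit. Unset Printing Implicit Defensive.
Import Order.TTheory GRing.Theory Num.Theory.
Local Open Scope ring_scope.
Local Open Scope quotient_scope.

(* Everything rests on one fact about a polynomial ring A over Z: on the torsion-free quotient
   of [Gt A] by [Ht A], division by p lowers the V-filtration by at most one step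
   ([Ht_Fil_divp]). Reading V^n_r as p^n times a formal p^n-th root of r, the relations say that
   V^(n+1)_(x^p) - p V^n_x is additive in x. The coefficients of these formal roots (well defined
   up to sign since x |-> x^p is injective on A) control an element up to a finite sum of such
   differences, and the latter are controlled by the ghost components. Hence G^0(A) is already
   torsion-free and separated, and an element g of [Gt (ZR R)] has its class in V^n C(R) iff
   g is in [Ht] + [Fil n] + (differences of symbols with equal image in R).

   A compatible map out of C(R) is then the continuous extension of V^n_r |-> V^n<r>, for any
   target that is complete for a filtration respected by V and <>: the V-adic one for a weak
   pre-Witt functor, the image of the product topology for E. When A is itself polynomial,
   Z[A] -> A splits, so torsion-freeness of C(A) follows from that of G(Z[A]). *)

(** * Filtrations, quotients and completions *)

Lemma subr_interchange (M : zmodType) (x y z t : M) : (x - y) - (z - t) = (x - z) - (y - t).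
Proof. by rewrite !opprB addrACA [RHS]addrACA (addrC (- y)). Qed.

Definition additive_map (M N : zmodType) (f : M -> N) := forall x y, f (x - y) = f x - f y.

Section AdditiveMap.
Variables (M N : zmodType) (f : M -> N) (fB : additive_map f).

Let F : {additive M -> N} := HB.pack f (GRing.isZmodMorphism.Build M N f fB).

Lemma amap0 : f 0 = 0. Proof. exact: (raddf0 F). Qed.
Lemma amapN x : f (- x) = - f x. Proof. exact: (raddfN F). Qed.
Lemma amapD x y : f (x + y) = f x + f y. Proof. exact: (raddfD F). Qed.
Lemma amapMn n x : f (x *+ n) = f x *+ n. Proof. exact: (raddfMn F). Qed.
Lemma amapMz n x : f (x *~ n) = f x *~ n. Proof. exact: (raddfMz F). Qed.
Lemma amap_sum I r P (E : I -> M) :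
  f (\sum_(i <- r | P i) E i) = \sum_(i <- r | P i) f (E i).
Proof. exact: (raddf_sum F). Qed.

Lemma gen_map (P : M -> Prop) (S : subgroup N) :
  (forall x, P x -> S (f x)) -> forall x, genS P x -> S (f x).
Proof.
move=> fP x; elim=> [|y|y z _ Sy _ Sz]; first by rewrite amap0; exact: sg0.
  exact: fP.
by rewrite fB; exact: sgB.
Qed.

Lemma saturation_map p (S : subgroup M) (S' : subgroup N) :
  (forall x, S x -> S' (f x)) -> forall x, saturation p S x -> saturation p S' (f x).
Proof. by move=> fS x [k Sx]; exists k; rewrite -amapMn; exact: fS. Qed.

Lemma closure_map (U : nat -> subgroup M) (U' : nat -> subgroup N) (S : subgroup M) (S' : subgroup N) :
  (forall n x, U n x -> U' n (f x)) -> (forall x, S x -> S' (f x)) ->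
  forall x, closure U S x -> closure U' S' (f x).
Proof.
move=> fU fS x Sx n; have [s Ss Us] := Sx n; exists (f s); first exact: fS.
by rewrite -fB; exact: fU.
Qed.
End AdditiveMap.

Lemma amap_comp (M N P : zmodType) (f : M -> N) (g : N -> P) :
  additive_map f -> additive_map g -> additive_map (g \o f).
Proof. by move=> fB gB x y /=; rewrite fB gB. Qed.

Lemma amap_iter (M : zmodType) (f : M -> M) n :
  additive_map f -> additive_map (iter n f).
Proof. by move=> fB; elim: n => [|n IH] x y //=; rewrite IH fB. Qed.

Lemma sgMz (M : zmodType) (S : subgroup M) x (n : int) : S x -> S (x *~ n).
Proof.
move=> Sx; case: n => n; first exact: (sgMn n Sx).
by rewrite NegzE mulrNz; apply: sgN; exact: (sgMn n.+1 Sx).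
Qed.

Lemma sg_sum (M : zmodType) (S : subgroup M) I (r : seq I) (E : I -> M) :
  (forall i, S (E i)) -> S (\sum_(i <- r) E i).
Proof. by move=> SE; elim/big_rec: _ => [|i x _ Sx]; [exact: sg0 | exact: sgD]. Qed.

Lemma sgBl (M : zmodType) (S : subgroup M) x y : S y -> S (x - y) <-> S x.
Proof.
move=> Sy; split=> [Sxy|Sx]; last exact: sgB.
by rewrite -(subrK y x); exact: sgD.
Qed.

Lemma gen_sub (M : zmodType) (P : M -> Prop) (S : subgroup M) :
  (forall x, P x -> S x) -> forall x, genS P x -> S x.
Proof. by move=> PS; apply: (@gen_map _ _ id) => // x y. Qed.

Section Quotg.
Variables (M : zmodType) (N : subgroup M).

Lemma quotgP x y : \pi_(quotg N) x = \pi_(quotg N) y <-> N (x - y).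
Proof.
split=> [/eqP|Nxy]; last apply/eqP.
  by rewrite -Quotient.idealrBE unfold_in => /asboolP.
by rewrite -Quotient.idealrBE unfold_in; apply/asboolP.
Qed.

Lemma quotgB x y : \pi_(quotg N) (x - y) = \pi_(quotg N) x - \pi_(quotg N) y.
Proof. by rewrite raddfB. Qed.

Lemma quotg0 x : \pi_(quotg N) x = 0 <-> N x.
Proof. by have := quotgP x 0; rewrite raddf0 subr0. Qed.

Lemma qimgP (S : subgroup M) x : qimg N S (\pi_(quotg N) x) <-> exists2 s, S s & N (x - s).
Proof. by split=> -[s Ss /quotgP]; exists s. Qed.

Lemma qimgW (S : subgroup M) x : S x -> qimg N S (\pi_(quotg N) x).
Proof. by exists x. Qed.
End Quotg.

Section Qlift.
Variables (M M' : zmodType) (N : subgroup M) (N' : subgroup M') (f : M -> M').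
Hypotheses (fB : additive_map f) (fN : forall x, N x -> N' (f x)).

Lemma qlift_pi x : qlift N N' f (\pi_(quotg N) x) = \pi_(quotg N') (f x).
Proof. by apply/quotgP; rewrite -fB; apply/fN/quotgP; rewrite reprK. Qed.

Lemma qliftB : additive_map (qlift N N' f).
Proof.
move=> q r; rewrite -(reprK q) -(reprK r).
by rewrite -(quotgB N) !qlift_pi fB quotgB.
Qed.

Lemma qlift_qimg (S : subgroup M) (S' : subgroup M') :
  (forall x, S x -> S' (f x)) -> forall q, qimg N S q -> qimg N' S' (qlift N N' f q).
Proof. by move=> fS _ [x Sx ->]; rewrite qlift_pi; apply/qimgW/fS. Qed.
End Qlift.

Section SubT.
Variables (M : zmodType) (S : subgroup M).

Lemma subT_valB (x y : subT S) : subT_val (x - y) = subT_val x - subT_val y.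
Proof. exact: (raddfB (val : subT S -> M)). Qed.

Lemma subT_val_insubd x : S x -> subT_val (insubd (0 : subT S) x) = x.
Proof. by move=> Sx; apply: (insubdK (0 : subT S)); rewrite unfold_in; apply/asboolP. Qed.

Lemma subT_valP (x : subT S) : S (subT_val x).
Proof. by have := valP x; rewrite /= unfold_in => /asboolP. Qed.

Lemma subT_inj (x y : subT S) : subT_val x = subT_val y -> x = y.
Proof. exact: val_inj. Qed.

Lemma exists_subT x : S x -> exists y : subT S, subT_val y = x.
Proof. by exists (insubd (0 : subT S) x); exact: subT_val_insubd. Qed.
End SubT.

Record complete_filtration (M : zmodType) (U : nat -> subgroup M) : Prop := {
  cfiltS : forall n x, U n.+1 x -> U n x;
  cfilt_sep : forall x, (forall n, U n x) -> x = 0;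
  cfilt_lim : forall s : nat -> M, (forall n, U n (s n.+1 - s n)) ->
    exists a, forall n, U n (a - s n) }.

Lemma filt_le (M : zmodType) (U : nat -> subgroup M) :
  (forall n x, U n.+1 x -> U n x) -> forall m n x, (m <= n)%N -> U n x -> U m x.
Proof.
move=> US m n x /subnK <-; elim: (n - m)%N => // k IH; rewrite addSn => /US.
exact: IH.
Qed.

(** Separation comes from the closure: an element that agrees with [U n] up to [closure U S] for
    every [n] is itself in that closure. Limits come from lifting a Cauchy sequence of classes to a
    Cauchy sequence in [M]. *)
Lemma quot_complete (M : zmodType) (U : nat -> subgroup M) (S : subgroup M) :
  complete_filtration U ->
  complete_filtration (fun n => qimg (closure U S) (U n)).
Proof.
case=> US _ lim; split=> [n _ [x Ux ->]|q|s Cs].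
- exact/qimgW/US.
- rewrite -(reprK q) => Uq; apply/quotg0 => n.
  have /qimgP[y Uy /(_ n)[t St Ut]] := Uq n; exists t => //.
  by apply/(sgBl _ Uy); rewrite addrAC.
- have /boolp.choice[u uP] : forall n, exists u, U n u /\ s n.+1 - s n = \pi_(quotg (closure U S)) u.
    by move=> n; have [u Uu us] := Cs n; exists u.
  (* Arbitrary representatives of the [s n] need not form a Cauchy sequence. Starting from one of
     them and adding increments [u m] taken in [U m] gives lifts that do. *)
  pose g := fix g n := if n is m.+1 then g m + u m else repr (s 0%N).
  have gs n : \pi_(quotg (closure U S)) (g n) = s n.
    elim: n => [|n IH]; first by rewrite reprK.
    by rewrite /= raddfD /= IH -(uP n).2 addrC subrK.
  have [n|a ag] := lim g; first by rewrite /= addrAC subrr add0r; exact: (uP n).1.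
  exists (\pi_(quotg (closure U S)) a) => n.
  by rewrite -gs -quotgB; exact/qimgW/ag.
Qed.

(** * Completions and continuous extension of additive maps *)

Section CompletionTheory.
Variables (M : zmodType) (U : nat -> subgroup M).
Hypothesis US : forall n x, U n.+1 x -> U n x.

Lemma csB (x y : CS U) n : subT_val (x - y) n = subT_val x n - subT_val y n.
Proof. by rewrite subT_valB. Qed.

Lemma completionP (x y : CS U) :
  \pi_(completion U) x = \pi_(completion U) y <->
  forall n, U n (subT_val x n - subT_val y n).
Proof.
split=> [/quotgP xy n|xy]; first by have := xy n; rewrite /= /fil_pred csB.
by apply/quotgP => n; rewrite /= /fil_pred csB; exact: xy.
Qed.

Lemma compl_nbhdP n (x : CS U) :
  compl_nbhd U n (\pi_(completion U) x) <-> U n (subT_val x n).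
Proof.
split=> [/qimgP[y /= yn /(_ n)]|Ux]; last exact: qimgW.
by rewrite /= /fil_pred csB => /(sgBl _ yn).
Qed.

Lemma compl_embed_val m : subT_val (insubd (0 : CS U) (fun=> m)) = fun=> m.
Proof. by rewrite subT_val_insubd // => n; rewrite subrr; exact: sg0. Qed.

Lemma compl_embedB : additive_map (compl_embed U).
Proof.
move=> x y; rewrite /compl_embed -quotgB; congr (\pi _); apply: subT_inj.
by rewrite subT_valB !compl_embed_val.
Qed.

Lemma compl_embed_nbhd n m : compl_nbhd U n (compl_embed U m) <-> U n m.
Proof. by rewrite /compl_embed compl_nbhdP compl_embed_val. Qed.

(** The limit of a Cauchy sequence of classes is the diagonal sequence, whose [n]-th term is the
    [n]-th term of a representative of [s n]. *)
Lemma completion_complete : complete_filtration (compl_nbhd U).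
Proof.
have Cseq (x : CS U) n : U n (subT_val x n.+1 - subT_val x n) := subT_valP x n.
split=> [n q|q Uq|s Cs].
- rewrite -(reprK q) => /compl_nbhdP/US Ux; apply/compl_nbhdP.
  by rewrite -(subKr (subT_val (repr q) n.+1) (subT_val _ n)); exact: sgB.
- rewrite -(reprK q); apply/quotg0 => n; apply/compl_nbhdP; rewrite reprK.
  exact: Uq.
- have rs n : U n (subT_val (repr (s n.+1)) n - subT_val (repr (s n)) n).
    by rewrite -csB -compl_nbhdP quotgB !reprK.
  have [|a aE] := @exists_subT _ (cauchy U) (fun n => subT_val (repr (s n)) n).
    move=> n; rewrite -(subrK (subT_val (repr (s n.+1)) n) (subT_val _ n.+1)) -addrA.
    by apply: sgD => //; exact: Cseq.
  exists (\pi_(completion U) a) => n; rewrite -(reprK (s n)) -quotgB.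
  by apply/compl_nbhdP; rewrite csB aE subrr; exact: sg0.
Qed.

(** The approximant is the [k]-th term of a representative. It stays in [U n] because the [n]-th
    term does and all later increments lie in [U n]. *)
Lemma compl_dense n k q : (n <= k)%N -> compl_nbhd U n q ->
  exists2 m, U n m & compl_nbhd U k (q - compl_embed U m).
Proof.
move=> le_nk; rewrite -(reprK q) => /compl_nbhdP Uq.
exists (subT_val (repr q) k).
  rewrite -(subnKC le_nk); elim: (k - n)%N => [|j IH]; first by rewrite addn0.
  rewrite addnS -(subrK (subT_val (repr q) (n + j)) (subT_val _ _)).
  apply: sgD => //; apply: (filt_le US (leq_addr j n)); exact: (subT_valP (repr q)).
by rewrite -quotgB compl_nbhdP csB compl_embed_val subrr; exact: sg0.
Qed.
End CompletionTheory.

Section ComplLift.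
Variables (M M' : zmodType) (U : nat -> subgroup M) (U' : nat -> subgroup M').
Variable f : M -> M'.
Hypotheses (fB : additive_map f) (fU : forall n x, U n x -> U' n (f x)).

(** [compl_lift] goes through a chosen representative and the default value of [insubd]. Additivity
    and continuity of [f] make both choices harmless, so any representative may be used. *)
Lemma compl_lift_pi (x : CS U) (y : CS U') :
  (forall n, subT_val y n = f (subT_val x n)) ->
  compl_lift U U' f (\pi_(completion U) x) = \pi_(completion U') y.
Proof.
move=> yx; apply/completionP => n; rewrite subT_val_insubd; last first.
  by move=> m; rewrite -fB; apply: fU; exact: (subT_valP (repr (\pi_(completion U) x))).
by rewrite yx -fB; apply: fU; apply: (iffLR (completionP _ _)); rewrite reprK.
Qed.

Lemma compl_lift_ex (x : CS U) :
  exists y : CS U', forall n, subT_val y n = f (subT_val x n).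
Proof.
have [|y yE] := @exists_subT _ (cauchy U') (fun n => f (subT_val x n)).
  by move=> n; rewrite -fB; apply: fU; exact: (subT_valP x).
by exists y => n; rewrite yE.
Qed.

Lemma compl_liftB : additive_map (compl_lift U U' f).
Proof.
move=> q r; rewrite -(reprK q) -(reprK r) -(quotgB (null U)).
have [x xE] := compl_lift_ex (repr q); have [y yE] := compl_lift_ex (repr r).
rewrite (compl_lift_pi xE) (compl_lift_pi yE) -quotgB.
by apply: compl_lift_pi => n; rewrite !csB xE yE fB.
Qed.

Lemma compl_lift_embed m :
  compl_lift U U' f (compl_embed U m) = compl_embed U' (f m).
Proof. by apply: compl_lift_pi => n; rewrite !compl_embed_val. Qed.

(** Term [d + n] of a representative is reached from term [n] by increments in [U n], so it still
    lies in [U n] and [f] sends it to [U' (d + n)]. *)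
Lemma compl_lift_shift d : (forall n x, U n.+1 x -> U n x) ->
  (forall n x, U n x -> U' (d + n)%N (f x)) ->
  forall n q, compl_nbhd U n q -> compl_nbhd U' (d + n) (compl_lift U U' f q).
Proof.
move=> US fUd n q Uq; have [x xE] := compl_lift_ex (repr q).
rewrite -(reprK q) (compl_lift_pi xE); apply/compl_nbhdP; rewrite xE; apply: fUd.
rewrite -(reprK q) in Uq; have /compl_nbhdP Uq' := Uq.
elim: d => [|j IH] //; rewrite addSn -(subrK (subT_val (repr q) (j + n)) (subT_val _ _)).
apply: sgD => //; apply: (filt_le US (leq_addl j n)); exact: (subT_valP (repr q)).
Qed.
End ComplLift.

(** * The free group on the symbols *)

Section LinearExtension.
Variables (K : choiceType) (M : zmodType) (F : K -> M).

Definition linext (g : {malg int[K]}) : M := \sum_(k <- msupp g) F k *~ g@_k.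

Lemma linextw (d : {fset K}) g : (msupp g `<=` d)%fset ->
  linext g = \sum_(k <- d) F k *~ g@_k.
Proof.
move=> gd; rewrite /linext; apply: (big_fset_incl _ gd) => k _ /mcoeff_outdom ->.
exact: mulr0z.
Qed.

Lemma linextB : additive_map linext.
Proof.
move=> g h; pose d := (msupp g `|` msupp h)%fset.
rewrite (@linextw d (g - h)) ?msuppB_le // (@linextw d g) ?fsubsetUl //.
rewrite (@linextw d h) ?fsubsetUr // -sumrB; apply: eq_bigr => k _.
by rewrite mcoeffB mulrzBr.
Qed.

Lemma linextU k : linext << k >> = F k.
Proof. by rewrite /linext msuppU big_seq_fset1 mcoeffUU. Qed.
End LinearExtension.

Section Malg.
Variable K : choiceType.

Lemma malgUz (c : int) (k : K) : << c *g k >> = << k >> *~ c :> {malg int[K]}.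
Proof. by rewrite -(raddfMz (@mkmalgU K int k)) -mulrzl mulr1 intz. Qed.

Lemma malg_gen (S : subgroup {malg int[K]}) : (forall k, S << k >>) -> forall g, S g.
Proof.
by move=> Sk g; rewrite (monalgE g); apply: sg_sum => k; rewrite malgUz; exact: sgMz.
Qed.
End Malg.

Section Equalizer.
Variables (M N : zmodType) (f g : M -> N) (fB : additive_map f) (gB : additive_map g).

Fact equalizer0 : f 0 = g 0. Proof. by rewrite !amap0. Qed.
Fact equalizerB x y : f x = g x -> f y = g y -> f (x - y) = g (x - y).
Proof. by rewrite fB gB => -> ->. Qed.
(** Agreement of two additive maps is packaged as a subgroup, so that induction on generators
    ([malg_gen], [Gt_gen]) proves equalities of maps. *)
Definition equalizer := Subgroup equalizer0 equalizerB.
End Equalizer.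

Section Preimage.
Variables (M N : zmodType) (f : M -> N) (fB : additive_map f) (S : subgroup N).

Fact preimg0 : S (f 0). Proof. by rewrite amap0 //; exact: sg0. Qed.
Fact preimgB x y : S (f x) -> S (f y) -> S (f (x - y)).
Proof. by rewrite fB; exact: sgB. Qed.
Definition preimg := Subgroup preimg0 preimgB.
End Preimage.

Section SumSubgroup.
Variables (M : zmodType) (S T : subgroup M).

Definition sum_pred (x : M) := exists2 y, S y & T (x - y).
Fact sum_sg0 : sum_pred 0.
Proof. by exists 0; [exact: sg0 | rewrite subr0; exact: sg0]. Qed.
Fact sum_sgB x y : sum_pred x -> sum_pred y -> sum_pred (x - y).
Proof.
move=> [s Ss Tx] [t St Ty]; exists (s - t); first exact: sgB.
by rewrite subr_interchange; exact: sgB.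
Qed.
Definition sum_sg := Subgroup sum_sg0 sum_sgB.

Lemma sum_sgl x : S x -> sum_sg x.
Proof. by exists x => //; rewrite subrr; exact: sg0. Qed.

Lemma sum_sgr x : T x -> sum_sg x.
Proof. by exists 0; [exact: sg0 | rewrite subr0]. Qed.
End SumSubgroup.

Section SymTheory.
Variable A : comPzRingType.
Implicit Types (r : A) (g : Gt A).

Lemma sym0 n : sym n (0 : A) = 0.
Proof. by rewrite /sym insubF ?eqxx. Qed.

Lemma symE n (r : {r : A | r != 0}) : sym n (val r) = << ((n, r) : Sym A) >>.
Proof. by rewrite /sym valK. Qed.

Lemma Gt_gen (S : subgroup (Gt A)) : (forall n r, S (sym n r)) -> forall g, S g.
Proof.
move=> Sn; apply: (@malg_gen (Sym A) S) => -[n r].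
by have := Sn n (val r); rewrite symE.
Qed.

Lemma Gt_eq (M : zmodType) (f h : Gt A -> M) : additive_map f -> additive_map h ->
  (forall n r, f (sym n r) = h (sym n r)) -> forall g, f g = h g.
Proof. by move=> fB hB fh g; apply: (@Gt_gen (equalizer fB hB)). Qed.

Lemma Fil_sym n m r : (n <= m)%N -> Fil A n (sym m r).
Proof. by move=> nm; apply: gen_in; exists m, r. Qed.

Lemma FilS n g : Fil A n.+1 g -> Fil A n g.
Proof. by apply: gen_sub => _ [m [r [nm ->]]]; exact/Fil_sym/ltnW. Qed.

Lemma Fil0 g : Fil A 0 g.
Proof. by apply: Gt_gen => n r; exact: Fil_sym. Qed.

Section Ext.
Variables (M : zmodType) (F : nat -> A -> M).

Definition gtext : Gt A -> M := linext (fun k : Sym A => F k.1 (val k.2)).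

Lemma gtextB : additive_map gtext. Proof. exact: linextB. Qed.

(** Only nonzero elements of [A] index the basis. The condition on [F n 0] matches the convention
    V^n_0 = 0 built into [sym]. *)
Lemma gtext_sym : (forall n, F n 0 = 0) -> forall n r, gtext (sym n r) = F n r.
Proof.
move=> F0 n r; have [->|r0] := eqVneq r 0; first by rewrite sym0 F0 amap0 //; exact: gtextB.
by rewrite -[r]/(val (exist (fun r => r != 0) r r0)) symE /gtext linextU.
Qed.
End Ext.

Lemma VtE g : Vt g = linext (fun k : Sym A => << ((k.1.+1, k.2) : Sym A) >>) g.
Proof. by apply: eq_bigr => k _; rewrite malgUz. Qed.

Lemma VtB : additive_map (@Vt A).
Proof. by move=> g h; rewrite !VtE linextB. Qed.

Lemma Vt_sym n r : Vt (sym n r) = sym n.+1 r.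
Proof.
have [->|r0] := eqVneq r 0; first by rewrite !sym0 amap0 //; exact: VtB.
by rewrite -[r]/(val (exist (fun r => r != 0) r r0)) !symE VtE linextU.
Qed.

Lemma iter_Vt_sym k n r : iter k (@Vt A) (sym n r) = sym (k + n) r.
Proof. by elim: k => //= k ->; rewrite Vt_sym. Qed.

Lemma Vt_Fil n g : Fil A n g -> Fil A n.+1 (Vt g).
Proof.
by apply: (gen_map VtB) => _ [m [r [nm ->]]]; rewrite Vt_sym; exact: Fil_sym.
Qed.

(** The filtration by symbols is the V-adic one already on [Gt A], since V^m_r = V^n(V^(m-n)_r) for
    m >= n. *)
Lemma Fil_Vt n g : Fil A n g -> exists h, g = iter n (@Vt A) h.
Proof.
elim=> [|_ [m [r [nm ->]]]|x y _ [a ->] _ [b ->]].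
- by exists 0; rewrite (amap0 (amap_iter n VtB)).
- by exists (sym (m - n) r); rewrite iter_Vt_sym subnKC.
- by exists (a - b); rewrite (amap_iter n VtB).
Qed.
End SymTheory.

Section GtMap.
Variables (A B : comPzRingType) (phi : A -> B).

Lemma GtmapE g : Gtmap phi g = gtext (fun n r => sym n (phi r)) g.
Proof. by []. Qed.

Lemma GtmapB : additive_map (Gtmap phi).
Proof. exact: (gtextB (fun n r => sym n (phi r))). Qed.

Hypothesis phi0 : phi 0 = 0.

Lemma Gtmap_sym n r : Gtmap phi (sym n r) = sym n (phi r).
Proof. by rewrite GtmapE gtext_sym // => m; rewrite phi0 sym0. Qed.

Lemma Gtmap_Fil n g : Fil A n g -> Fil B n (Gtmap phi g).
Proof.
by apply: (gen_map GtmapB) => _ [m [r [nm ->]]]; rewrite Gtmap_sym; exact: Fil_sym.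
Qed.
End GtMap.

Section Relations.
Variables (p : nat) (A : comPzRingType).
Implicit Types (M : zmodType) (x y r : A) (g : Gt A).

Lemma hrel_map (B : comPzRingType) (phi : {rmorphism A -> B}) n x y :
  Gtmap phi (hrel p n x y) = hrel p n (phi x) (phi y).
Proof.
have fB := GtmapB phi; rewrite /hrel !fB !(amapMn fB) !Gtmap_sym ?rmorph0 //.
by rewrite !rmorphXn !rmorphD.
Qed.

Lemma Gtmap_H (B : comPzRingType) (phi : {rmorphism A -> B}) g :
  H p A g -> H p B (Gtmap phi g).
Proof.
apply: (gen_map (GtmapB phi)) => _ [[n [x [y [n0 ->]]]]|[n [r ->]]].
  by apply: gen_in; left; exists n, (phi x), (phi y); rewrite hrel_map.
apply: gen_in; right; exists n, (phi r).
by rewrite (amapD (GtmapB phi)) !Gtmap_sym ?rmorph0 // rmorphN.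
Qed.

Lemma Gtmap_Ht (B : comPzRingType) (phi : {rmorphism A -> B}) g :
  Ht p A g -> Ht p B (Gtmap phi g).
Proof. by apply: (saturation_map (GtmapB phi)); exact: Gtmap_H. Qed.

Lemma Vt_Ht g : Ht p A g -> Ht p A (Vt g).
Proof.
apply: (saturation_map (@VtB A)); apply: (gen_map (@VtB A)).
move=> _ [[[|n] [x [y [// _ ->]]]]|[n [r ->]]].
  apply: gen_in; left; exists n.+2, x, y; split=> //.
  have fB := @VtB A.
  by rewrite /hrel !fB !(amapMn fB) !Vt_sym.
by apply: gen_in; right; exists n.+1, r; rewrite (amapD (@VtB A)) !Vt_sym.
Qed.

(* [deltaG n x] is minus the ghost component [p^(n+1) x] at position [n]. *)
Definition deltaG n x : Gt A := sym n.+1 (x ^+ p) - sym n x *+ p.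

Lemma hrelE n x y : hrel p n.+1 x y = deltaG n (x + y) - deltaG n x - deltaG n y.
Proof. by []. Qed.

(** The two hypotheses are the two families of generators of [H], the first one read through
    [hrelE]. Generators [hrel p n] have n >= 1, so the shift to [n.+1] loses nothing. *)
Lemma H_kill M (f : Gt A -> M) : additive_map f ->
  (forall n x y, f (deltaG n (x + y)) = f (deltaG n x) + f (deltaG n y)) ->
  (forall n r, f (sym n (- r)) = - f (sym n r)) ->
  forall g, H p A g -> f g = 0.
Proof.
move=> fB fD fN g; elim=> [|h|h k _ fh _ fk]; first exact: amap0.
  case=> [[[|n] [x [y [// _ ->]]]]|[n [r ->]]].
    by rewrite hrelE (fB (_ - _)) (fB (deltaG _ _)) fD addrAC addrK subrr.
  by rewrite (amapD fB) fN subrr.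
by rewrite fB fh fk subr0.
Qed.

Lemma Ht_kill M (f : Gt A -> M) : additive_map f -> prime p ->
  (forall x : M, x *+ p = 0 -> x = 0) ->
  (forall g, H p A g -> f g = 0) ->
  forall g, Ht p A g -> f g = 0.
Proof.
move=> fB pp tf fH g [k /fH]; rewrite amapMn //.
by elim: k => [|k IH]; rewrite ?mulr1n // expnSr mulrnA => /tf.
Qed.
End Relations.

(** * Division by p *)

Section Multiples.
Variables (M : zmodType) (n : nat).

Fact multiples0 : exists y : M, 0 = y *+ n.
Proof. by exists 0; rewrite mul0rn. Qed.
Fact multiplesB (x y : M) : (exists z, x = z *+ n) -> (exists z, y = z *+ n) ->
  exists z, x - y = z *+ n.
Proof. by move=> [a ->] [b ->]; exists (a - b); rewrite mulrnBl. Qed.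
Definition multiples := Subgroup multiples0 multiplesB.
End Multiples.

Section TorsionFree.
Variables (p : nat) (M : zmodType).
Hypothesis tf : forall x : M, x *+ p = 0 -> x = 0.

Lemma pX_torsion_free k (x : M) : x *+ p ^ k = 0 -> x = 0.
Proof. by elim: k => [|k IH]; rewrite ?mulr1n // expnSr mulrnA => /tf. Qed.

Lemma pX_mulrnI k : injective (fun x : M => x *+ p ^ k).
Proof.
move=> x y /eqP; rewrite -subr_eq0 -mulrnBl => /eqP/pX_torsion_free/eqP.
by rewrite subr_eq0 => /eqP.
Qed.
End TorsionFree.

Section TorsionCriterion.
Variables (p : nat) (A : comPzRingType).
Hypotheses (p_pr : prime p) (p_odd : odd p).
Hypothesis powI : injective (fun x : A => x ^+ p).
Hypothesis tf : forall x : A, x *+ p = 0 -> x = 0.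

Let powpI k : injective (fun x : A => x ^+ (p ^ k)).
Proof.
elim: k => [|k IH] x y; first by rewrite !expr1.
by rewrite /= expnSr !exprM => /powI/IH.
Qed.

Let powpN k (x : A) : (- x) ^+ (p ^ k) = - x ^+ (p ^ k).
Proof. by rewrite exprNn -signr_odd oddX p_odd orbT expr1 mulN1r. Qed.

Let powN (x : A) : (- x) ^+ p = - x ^+ p.
Proof. by rewrite -[p]expn1 powpN. Qed.

Let zero_pX k : 0 ^+ (p ^ k) = 0 :> A.
Proof. by rewrite expr0n expn_eq0 (gtn_eqF (prime_gt0 p_pr)). Qed.

Let int_tf (x : int) : x *+ p = 0 -> x = 0.
Proof. by move/eqP; rewrite mulrn_eq0 (gtn_eqF (prime_gt0 p_pr)) => /eqP. Qed.

Let p_half : p = (p./2.*2).+1.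
Proof. by rewrite -[LHS]odd_double_half p_odd. Qed.

(* [V^n_r] is thought of as [p^n] times the formal root [r^(1/p^n)], up to sign; this is
   its coefficient at [s^(1/p^i)]. *)
Definition germ_coef i (s : A) : Gt A -> int :=
  gtext (fun n r => ((r ^+ (p ^ i) == s ^+ (p ^ n))%:Z - (r ^+ (p ^ i) == - s ^+ (p ^ n))%:Z) *+ p ^ n).

Lemma germ_coefB i s : additive_map (germ_coef i s). Proof. exact: gtextB. Qed.

Lemma germ_coef_sym i s n r : germ_coef i s (sym n r) =
  ((r ^+ (p ^ i) == s ^+ (p ^ n))%:Z - (r ^+ (p ^ i) == - s ^+ (p ^ n))%:Z) *+ p ^ n.
Proof.
rewrite /germ_coef gtext_sym // => m.
by rewrite zero_pX -eqr_oppLR oppr0 subrr mul0rn.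
Qed.

(** V^(n+1)_(x^p) and p V^n_x are both p^(n+1) times the same formal root. Injectivity of the p-th
    power identifies the two membership tests, and oddness of p does so for the test with the minus
    sign. *)
Lemma germ_coef_delta i s n x : germ_coef i s (deltaG p n x) = 0.
Proof.
rewrite /deltaG germ_coefB (amapMn (germ_coefB i s)) !germ_coef_sym.
rewrite -mulrnA -expnSr -mulrnBl exprAC expnSr exprM -powN.
by rewrite !(inj_eq powI) subrr mul0rn.
Qed.

Lemma germ_coefN i s n r : germ_coef i s (sym n (- r)) = - germ_coef i s (sym n r).
Proof.
by rewrite !germ_coef_sym powpN eqr_opp eqr_oppLR -mulNrn opprB.
Qed.

Lemma germ_coef_Ht i s g : Ht p A g -> germ_coef i s g = 0.
Proof.
apply: Ht_kill => //; first exact: germ_coefB.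
apply: H_kill; first exact: germ_coefB.
  by move=> n x y; rewrite !germ_coef_delta addr0.
exact: germ_coefN.
Qed.

Lemma germ_coef_Fil i s k g : Fil A k g -> multiples int (p ^ k) (germ_coef i s g).
Proof.
apply: (gen_map (germ_coefB i s)) => _ [m [r [km ->]]]; rewrite germ_coef_sym.
by rewrite -(subnK km) expnD mulrnA; eexists.
Qed.

(** The germ coefficients kill each V^(n+1)_(x^p) - p V^n_x and not only its defect of additivity.
    This subgroup therefore contains [H], and the ghost components measure what it adds. *)
Definition germ_ker : subgroup (Gt A) :=
  genS (fun g => (exists n x, g = deltaG p n x) \/ (exists n r, g = sym n r + sym n (- r))).

Lemma germ_coef_ker i s g : germ_ker g -> germ_coef i s g = 0.
Proof.
elim=> [|h|h k _ fh _ fk]; first exact: (amap0 (germ_coefB i s)).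
  case=> [[n [x ->]]|[n [r ->]]]; first exact: germ_coef_delta.
  by rewrite (amapD (germ_coefB i s)) germ_coefN subrr.
by rewrite germ_coefB fh fk subr0.
Qed.

(** * Raising the filtration by one step at level [i] *)

Section Level.
Variable i : nat.

Let level : Gt A -> Gt A := gtext (fun n r => if n == i then sym i r else 0).
(** [level] projects onto the symbols V^i_r, and [anti] antisymmetrises that projection in r. The
    coefficient of [anti g] at s is that of V^i_s minus that of V^i_(-s), in accordance with the
    sign convention of [germ_coef]. *)
Let anti : Gt A -> Gt A := gtext (fun n r => if n == i then sym i r - sym i (- r) else 0).

Let levelB : additive_map level. Proof. exact: gtextB. Qed.
Let antiB : additive_map anti. Proof. exact: gtextB. Qed.

Let level_sym n r : level (sym n r) = if n == i then sym i r else 0.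
Proof. by rewrite /level gtext_sym // => m; rewrite sym0 if_same. Qed.

Let anti_sym n r : anti (sym n r) = if n == i then sym i r - sym i (- r) else 0.
Proof. by rewrite /anti gtext_sym // => m; rewrite oppr0 subrr if_same. Qed.

Let level_anti g : level (anti g) = anti g.
Proof.
apply: (@Gt_eq A _ (level \o anti) anti) => [||n r /=]; first exact: (amap_comp antiB levelB).
  exact: antiB.
rewrite anti_sym; case: eqP => _; last exact: (amap0 levelB).
by rewrite levelB !level_sym eqxx.
Qed.

Let T := sum_sg (Fil A i.+1) germ_ker.

(** Modulo V^(i+1)_(r^p) - p V^i_r, the element p V^i_r is a symbol of level [i.+1]. *)
Let level_p g : T (level g *+ p).
Proof.
have fB : additive_map (fun g => level g *+ p) by move=> x y; rewrite levelB mulrnBl.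
apply: (@Gt_gen A (preimg fB T)) => n r; rewrite -[preimg _ _ _]/(T (level (sym n r) *+ p)).
rewrite level_sym; case: eqP => _; last by rewrite mul0rn; exact: sg0.
exists (sym i.+1 (r ^+ p)); first exact: Fil_sym.
by rewrite -opprB; apply/sgN/gen_in; left; exists i, r.
Qed.

Let level2 g : germ_ker (level g *+ 2 - anti g).
Proof.
have fB : additive_map (fun g => level g *+ 2 - anti g).
  by move=> x y; rewrite levelB antiB mulrnBl subr_interchange.
apply: (@Gt_gen A (preimg fB germ_ker)) => n r.
rewrite -[preimg _ _ _]/(germ_ker (level (sym n r) *+ 2 - anti (sym n r))).
rewrite level_sym anti_sym; case: eqP => _.
  by apply: gen_in; right; exists i, r; rewrite opprB mulr2n addrA addrAC addrK.
by rewrite mul0rn subrr; exact: sg0.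
Qed.
Let sym_coef n r m (s : {r : A | r != 0}) :
  (sym n r)@_((m, s) : Sym A) = ((n == m) && (r == val s))%:Z.
Proof.
have [->|r0] := eqVneq r 0.
  by have /= := valP s; rewrite sym0 mcoeff0 eq_sym => /negPf->; rewrite andbF.
rewrite -[r in LHS]/(val (exist (fun r => r != 0) r r0)) symE mcoeffU.
by rewrite xpair_eqE -val_eqE; case: (_ && _).
Qed.

(** At level [i] itself, r^(p^i) = s^(p^i) or -s^(p^i) means r = s or r = -s. Higher levels
    contribute only multiples of p^(i+1). *)
Let anti_coef g (s : {r : A | r != 0}) : Fil A i g ->
  multiples int (p ^ i.+1) (germ_coef i (val s) g - (anti g)@_((i, s) : Sym A) *+ p ^ i).
Proof.
pose f g : int := germ_coef i (val s) g - (anti g)@_((i, s) : Sym A) *+ p ^ i.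
have fB : additive_map f.
  by move=> x y; rewrite /f germ_coefB antiB mcoeffB mulrnBl subr_interchange.
apply: (gen_map fB) => _ [m [r [im ->]]]; rewrite /f germ_coef_sym anti_sym.
move: im; rewrite leq_eqVlt => /orP[/eqP<-|im].
  rewrite eqxx mcoeffB !sym_coef eqxx /= -powpN !(inj_eq (@powpI i)) eqr_oppLR subrr.
  exact: multiples0.
rewrite (gtn_eqF im) mcoeff0 mul0rn subr0 -(subnK im) expnD mulrnA.
by eexists.
Qed.

(** The hypothesis makes every coefficient of [anti g] divisible by p, so [level_p] pushes [anti g]
    up one level. Up to [germ_ker], [anti g] is twice [level g], and 2 and p are coprime. *)
Lemma germ_level g : Fil A i g -> (forall s, multiples int (p ^ i.+1) (germ_coef i s g)) ->
  sum_sg (Fil A i.+1) germ_ker g.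
Proof.
move=> gi gs; rewrite -/T.
have T_anti : T (anti g).
  rewrite -level_anti (monalgE (anti g)) (amap_sum levelB); apply: sg_sum => -[n s].
  have [->|ni] := eqVneq n i; last first.
    rewrite malgUz (amapMz levelB) -symE level_sym (negPf ni) mul0rz; exact: sg0.
  (* The difference of these two multiples of p^(i+1) is p^i times a coefficient of [anti g].
     Cancelling p^i shows that the coefficient is divisible by p. *)
  have [b] := sgB (gs (val s)) (anti_coef s gi).
  rewrite opprB addrC subrK expnS mulrnA => /(pX_mulrnI int_tf) ->.
  by rewrite monalgUMn (amapMn levelB); exact: level_p.
have T2 : T (level g *+ 2).
  by rewrite -(subrK (anti g) (_ *+ 2)); apply: sgD => //; apply: sum_sgr; exact: level2.
(* Since p is odd, 1 = p - 2 (p-1)/2, and both p and 2 times [level g] lie in [T]. *)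
have T1 : T (level g).
  have -> : level g = level g *+ p - level g *+ 2 *+ p./2.
    by rewrite -mulrnA mul2n [in X in X - _]p_half mulrSr addrAC subrr add0r.
  by apply: sgB; [exact: level_p | exact: sgMn].
rewrite -(subrK (level g) g); apply: sgD => //; apply: sum_sgl.
have fB : additive_map (fun g => g - level g).
  by move=> x y; rewrite levelB subr_interchange.
apply: (gen_map fB) gi => _ [m [r [im ->]]]; rewrite level_sym.
have [->|mi] := eqVneq m i; first by rewrite subrr; exact: sg0.
by rewrite subr0; apply: Fil_sym; rewrite ltn_neqAle eq_sym mi.
Qed.
End Level.

(** The filtration step is raised one at a time. Removing an element of [germ_ker] leaves the germ
    coefficients unchanged, so the remainder [z] inherits the divisibility of [g]. *)
Lemma germ_divisible k g : (forall i s, multiples int (p ^ k) (germ_coef i s g)) ->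
  sum_sg (Fil A k) germ_ker g.
Proof.
move=> gk; suff: forall j, (j <= k)%N -> sum_sg (Fil A j) germ_ker g by apply.
elim=> [|j IH] jk; first by apply: sum_sgl; exact: Fil0.
have [z zj gz] := IH (ltnW jk).
have [|y yj zy] := @germ_level j z zj.
  move=> s; have -> : germ_coef j s z = germ_coef j s g.
    by apply/esym/eqP; rewrite -subr_eq0 -germ_coefB germ_coef_ker.
  have [b ->] := gk j s; rewrite -(subnK jk) expnD mulrnA.
  by eexists.
by exists y => //; rewrite -(subrK z g) -addrA; exact: sgD.
Qed.

(** This is coordinate [j] of V^n<r> in the product of copies of [A], extended linearly from the
    symbols. *)
Definition ghost j : Gt A -> A :=
  gtext (fun n r => if (n <= j)%N then r ^+ (p ^ (j - n)) *+ p ^ n else 0).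

Lemma ghostB j : additive_map (ghost j). Proof. exact: gtextB. Qed.

Lemma ghost_sym j n r :
  ghost j (sym n r) = if (n <= j)%N then r ^+ (p ^ (j - n)) *+ p ^ n else 0.
Proof. by rewrite /ghost gtext_sym // => m; rewrite zero_pX mul0rn if_same. Qed.

(** Both terms of [deltaG] vanish before position [n] and cancel after it. At [n] itself only p
    V^n_x contributes. *)
Lemma ghost_delta j n x :
  ghost j (deltaG p n x) = if n == j then - (x *+ p ^ j.+1) else 0.
Proof.
rewrite /deltaG ghostB (amapMn (ghostB j)) !ghost_sym.
case: ltngtP => [nj|nj|->].
- by rewrite -mulrnA -expnSr -exprM -expnS -subSn // subSS subrr.
- by rewrite mul0rn subr0.
- by rewrite subnn expn0 expr1 sub0r -mulrnA -expnSr.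
Qed.

Lemma ghost_Ht j g : Ht p A g -> ghost j g = 0.
Proof.
apply: Ht_kill => //; first exact: ghostB.
apply: H_kill; first exact: ghostB.
  move=> n x y; rewrite !ghost_delta; case: eqP; rewrite ?addr0 // => _.
  by rewrite mulrnDl opprD.
move=> n r; rewrite !ghost_sym; case: leqP; rewrite ?oppr0 // => _.
by rewrite powpN mulNrn.
Qed.

Lemma ghost_Fil j k g : (j < k)%N -> Fil A k g -> ghost j g = 0.
Proof.
move=> jk; elim=> [|_ [m [r [km ->]]]|x y _ gx _ gy]; first exact: (amap0 (ghostB j)).
  by rewrite ghost_sym leqNgt (leq_trans jk km).
by rewrite ghostB gx gy subr0.
Qed.

Let delta0 n : deltaG p n (0 : A) = 0.
Proof. by rewrite /deltaG -[p]expn1 zero_pX !sym0 mul0rn subrr. Qed.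

(** Modulo [H] each [deltaG n] is additive, so all differences at one level merge into a single one.
    Allowing every N >= [N0] lets two such expressions be compared at a common length. *)
Lemma germ_ker_delta g : germ_ker g -> exists (a : nat -> A) (N0 : nat),
  forall N, (N0 <= N)%N -> H p A (g - \sum_(n < N) deltaG p n (a n)).
Proof.
elim=> [|h [[n [x ->]]|[n [r ->]]]|x y _ [a [Na xa]] _ [b [Nb yb]]].
- exists (fun=> 0), 0%N => N _; rewrite big1 ?subr0 //; exact: sg0.
- exists (fun m => if m == n then x else 0), n.+1 => N nN.
  rewrite (bigD1 (Ordinal nN)) //= eqxx big1; first by rewrite addr0 subrr; exact: gen_0.
  by move=> i; rewrite -val_eqE /= => /negPf->; exact: delta0.
- exists (fun=> 0), 0%N => N _; rewrite big1 ?subr0 //.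
  by apply: gen_in; right; exists n, r.
- exists (fun n => a n - b n), (maxn Na Nb) => N; rewrite geq_max => /andP[aN bN].
  (* This is the relation [hrel] for the pair (u - v, v). *)
  have Hd u v n : H p A (deltaG p n u - deltaG p n v - deltaG p n (u - v)).
    rewrite addrAC; apply: gen_in; left; exists n.+1, (u - v), v; split=> //.
    by rewrite hrelE subrK.
  pose S (c : nat -> A) := \sum_(n < N) deltaG p n (c n).
  have Hs : H p A (S a - S b - S (fun n => a n - b n)).
    by rewrite /S -!sumrB; exact: sg_sum.
  have E (u v s t w : Gt A) : u - s - (v - t) + (s - t - w) = u - v - w.
    by rewrite subr_interchange [LHS]addrA subrK.
  by have := sgD (sgB (xa N aN) (yb N bN)) Hs; rewrite -/(S a) -/(S b) (E x y).
Qed.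

Let p_gt0 := prime_gt0 p_pr.

(** Germ coefficients vanish on [Ht], so those of p g are divisible by p^(k+1) and those of g by
    p^k. Hence g is an element of [Fil k] plus elements [deltaG n (a n)], modulo [H]. The ghost
    components below [k] then force a n = 0 for n < k. *)
Lemma Ht_Fil_divp k g :
  sum_sg (Ht p A) (Fil A k.+1) (g *+ p) -> sum_sg (Ht p A) (Fil A k) g.
Proof.
move=> [h hH f_Fil]; set f := g *+ p - h in f_Fil.
have gf (M : zmodType) (F : Gt A -> M) : additive_map F -> F h = 0 -> F g *+ p = F f.
  by move=> FB Fh; rewrite FB Fh subr0 amapMn.
have [|z zk /germ_ker_delta[a [N /(_ N (leqnn N))]]] := @germ_divisible k g.
  move=> i s; have [b] := germ_coef_Fil i s f_Fil.
  rewrite -gf; [|exact: germ_coefB|exact: germ_coef_Ht].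
  rewrite expnSr mulrnA => /(@pX_mulrnI p int int_tf 1) ->; exact: ex_intro.
set S := \sum_(n < N) _ => gS.
(* At position j < k the ghost components of [g] and [z] both vanish, which leaves p^(j+1) a j =
   0. *)
have a0 (j : 'I_N) : (j < k)%N -> a j = 0.
  move=> jk; apply: (@pX_torsion_free p A tf j.+1).
  have HtH x : H p A x -> Ht p A x by exists 0%N.
  have := ghost_Ht j (HtH _ gS); rewrite !ghostB (ghost_Fil jk zk) subr0.
  have -> : ghost j g = 0.
    apply: tf; rewrite gf; [|exact: ghostB|exact: ghost_Ht].
    by rewrite (ghost_Fil _ f_Fil) // ltnW.
  have -> : ghost j S = \sum_(n < N) (if n == j :> nat then - (a n *+ p ^ j.+1) else 0).
    rewrite /S (amap_sum (ghostB j)); apply: eq_bigr => n _; exact: ghost_delta.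
  rewrite (bigD1 j) //= eqxx big1; first by rewrite addr0 sub0r opprK.
  by move=> i; rewrite -val_eqE => /negPf->.
exists (g - z - S); first by exists 0%N.
rewrite -addrA -opprD opprB addrC subrK addrC.
apply: sgD => //; apply: sg_sum => j.
(* The surviving differences have index at least [k] and so lie in [Fil k]. *)
have [jk|kj] := ltnP j k; first by rewrite a0 // delta0; exact: sg0.
by apply: sgB; [|apply: sgMn]; apply: Fil_sym => //; exact: leqW.
Qed.
End TorsionCriterion.

(** * Polynomial rings over the integers *)

Section OddPowers.
Variable p : nat.
Hypothesis p_odd : odd p.

Lemma int_powI : injective (fun x : int => x ^+ p).
Proof.
have p_gt0 : (0 < p)%N by case: p p_odd.
have nneg (x y : int) : 0 <= x -> x ^+ p = y ^+ p -> x = y.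
  move=> x0 xy; have y0 : 0 <= y by rewrite -(exprn_odd_ge0 y p_odd) -xy exprn_ge0.
  by apply/eqP; rewrite -(eqrXn2 p_gt0) // xy.
move=> x y /= xy; have [x0|x0] := lerP 0 x; first exact: nneg xy.
apply: oppr_inj; apply: nneg; first by rewrite oppr_ge0 ltW.
by rewrite (exprNn x) (exprNn y) xy.
Qed.

(** If the p-th powers agree, then u and v agree at every natural number by the integer case, which
    gives u - v more roots than a nonzero polynomial allows. *)
Lemma poly_int_powI : injective (fun u : {poly int} => u ^+ p).
Proof.
move=> u v /= uv; apply/eqP; rewrite -subr_eq0; apply: contraT => uv0.
have /= := max_poly_roots uv0 (rs := [seq Posz i | i <- iota 0 (size (u - v))]).
rewrite size_map size_iota ltnn => -> //.
  apply/allP => _ /mapP[i _ ->]; rewrite /root hornerD hornerN subr_eq0; apply/eqP.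
  by apply: int_powI => /=; rewrite -!horner_exp uv.
by rewrite map_inj_uniq ?iota_uniq // => i j [].
Qed.
End OddPowers.

Section Polynomials.
Variables (Xv : choiceType) (S : comPzRingType).
Implicit Types (m : {cmonom Xv}).

Definition monomial_map (h : {cmonom Xv} -> S) :=
  h mone = 1 /\ forall m m', h (mmul m m') = h m * h m'.

Lemma monomial_map_eq h h' : monomial_map h -> monomial_map h' ->
  (forall x, h (ucm x) = h' (ucm x)) -> forall m, h m = h' m.
Proof.
move=> [h1 hM] [h'1 h'M] hx m.
have [n] := ubnP (mdeg m); elim: n m => // n IH m mn.
have [->|m1] := eqVneq m mone; first by rewrite h1 h'1.
have [x mx] : exists x, (0 < m x)%N.
  apply: contrapT => /forallNP m0; case/negP: m1; apply/cmP => x.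
  by rewrite cm1; apply/eqP; rewrite -leqn0 leqNgt; exact/negP/m0.
have mE : m = mmul (ucm x) (divcm m (ucm x)).
  by apply/eqP/cmP => y; rewrite cmM divcmE cmU; case: eqP => [<-|_]; rewrite ?subnKC ?subn0.
rewrite mE hM h'M hx IH //; move: mn; rewrite {1}mE mdegM mdegU; exact.
Qed.

Section Evaluation.
Variable v : Xv -> S.

Definition monomial_eval m : S := \prod_(x <- finsupp m) v x ^+ m x.

Lemma monomial_evalw (d : {fset Xv}) m : (finsupp m `<=` d)%fset ->
  monomial_eval m = \prod_(x <- d) v x ^+ m x.
Proof.
move=> md; apply: (big_fset_incl _ md) => x _; rewrite -cmE_eq0 => /eqP->.
exact: expr0.
Qed.

Lemma monomial_evalP : monomial_map monomial_eval.
Proof.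
split=> [|m m']; first by rewrite /monomial_eval mdom1 big_nil.
pose d := (finsupp m `|` finsupp m')%fset.
rewrite (@monomial_evalw d m) ?fsubsetUl // (@monomial_evalw d m') ?fsubsetUr //.
rewrite -big_split /= (@monomial_evalw d) ?mdomD //; apply: eq_bigr => x _.
by rewrite cmM exprD.
Qed.

Lemma monomial_evalU x : monomial_eval (ucm x) = v x.
Proof. by rewrite /monomial_eval mdomU big_seq_fset1 cmUU expr1. Qed.
End Evaluation.

Lemma malgUM m m' : << m >> * << m' >> = << mmul m m' >> :> {malg int[{cmonom Xv}]}.
Proof. by rewrite [LHS]malgM_def fgmulUU mulr1. Qed.

Lemma linext_monoid_morphism (h : {cmonom Xv} -> S) : monomial_map h ->
  monoid_morphism (linext h).
Proof.
move=> [h1 hM]; split=> [|a b]; first by rewrite -mpolyC1E linextU.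
have lB := linextB h.
have multl (c : {malg int[{cmonom Xv}]}) : additive_map (fun a => linext h (a * c)).
  by move=> x y; rewrite mulrBl lB.
have multr (c : {malg int[{cmonom Xv}]}) : additive_map (fun a => linext h (c * a)).
  by move=> x y; rewrite mulrBr lB.
have scall (c : S) : additive_map (fun a => linext h a * c).
  by move=> x y; rewrite lB mulrBl.
have scalr (c : S) : additive_map (fun a => c * linext h a).
  by move=> x y; rewrite lB mulrBr.
apply: (@malg_gen _ (equalizer (multl b) (scall _))) => m /=.
apply: (@malg_gen _ (equalizer (multr << m >>) (scalr _))) => m' /=.
rewrite malgUM; transitivity (h (mmul m m')); first exact: linextU.
by rewrite hM; congr (_ * _); exact/esym/linextU.
Qed.

Definition poly_eval (v : Xv -> S) (a : {malg int[{cmonom Xv}]}) : S :=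
  linext (monomial_eval v) a.

Lemma poly_eval_morphism v :
  exists f : {rmorphism {malg int[{cmonom Xv}]} -> S}, forall a, f a = poly_eval v a.
Proof.
pose fB := GRing.isZmodMorphism.Build _ _ _ (@linextB _ _ (monomial_eval v)).
pose fM := GRing.isMonoidMorphism.Build _ _ _ (linext_monoid_morphism (monomial_evalP v)).
by exists (HB.pack (linext (monomial_eval v)) fB fM : {rmorphism _ -> _}).
Qed.

Lemma poly_evalU v x : poly_eval v << ucm x >> = v x.
Proof. by rewrite /poly_eval linextU monomial_evalU. Qed.

Lemma poly_rmorphism_eq (f g : {rmorphism {malg int[{cmonom Xv}]} -> S}) :
  (forall x, f << ucm x >> = g << ucm x >>) -> forall a, f a = g a.
Proof.
move=> fg; apply: (@malg_gen _ (equalizer (raddfB f) (raddfB g))) => m /=.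
have mon (h : {rmorphism {malg int[{cmonom Xv}]} -> S}) : monomial_map (fun m => h << m >>).
  split=> [|x y]; first by rewrite -[RHS](rmorph1 h) -mpolyC1E.
  by rewrite -rmorphM malgUM.
exact: (monomial_map_eq (mon f) (mon g)).
Qed.
End Polynomials.

(** * Kronecker substitution and injectivity of odd powers *)

Section Kronecker.
Variables (Xv : choiceType) (M : nat).

(** This is the number whose base-[M] digits are the exponents of [m] along [vs], the lowest digit
    coming first. *)
Definition weight (vs : seq Xv) (m : {cmonom Xv}) : nat := \sum_(x <- vs) m x * M ^ index x vs.

Lemma weight_cons x vs m : uniq (x :: vs) -> weight (x :: vs) m = (m x + weight vs m * M)%N.
Proof.
move=> /= /andP[xvs _]; rewrite /weight big_cons /= eqxx muln1 big_distrl /=; congr addn.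
rewrite big_seq [RHS]big_seq; apply: eq_bigr => y yvs.
by case: eqP => [xy|_]; [rewrite xy yvs in xvs | rewrite expnSr mulnA].
Qed.

(** Digits below [M] are recovered one by one: reduction modulo [M] gives the first exponent, and
    division by [M] leaves the weight of the tail. *)
Lemma weight_inj vs (m m' : {cmonom Xv}) : uniq vs ->
  (forall x, x \in vs -> (m x < M)%N /\ (m' x < M)%N) ->
  weight vs m = weight vs m' -> forall x, x \in vs -> m x = m' x.
Proof.
elim: vs => // x vs IH xvs mM; rewrite !weight_cons //.
have [mx m'x] := mM x (mem_head _ _).
move=> /[dup] /(congr1 (modn^~ M)); rewrite ![(_ + _ * M)%N]addnC !modnMDl !modn_small //.
move=> mE; rewrite mE => /addIn/eqP; rewrite eqn_pmul2r ?(leq_ltn_trans _ mx) // => /eqP wE y.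
rewrite inE => /predU1P[->//|yvs]; case/andP: xvs => _ uvs.
by apply: IH => // z zvs; apply: mM; rewrite inE zvs orbT.
Qed.
End Kronecker.

Section PolynomialPowers.
Variable Xv : choiceType.
Implicit Types a b : {malg int[{cmonom Xv}]}.

(* Kronecker's substitution of high powers of one variable. *)
Lemma poly_separation a : a != 0 ->
  exists f : {rmorphism {malg int[{cmonom Xv}]} -> {poly int}}, f a != 0.
Proof.
(* The base [M] exceeds the degree of every monomial of [a], hence every exponent, so distinct
   monomials of [a] get distinct weights. *)
move=> a0; pose d := (\bigcup_(m <- msupp a) finsupp m)%fset.
pose M := (\max_(m <- msupp a) mdeg m).+1; pose w m := weight M (enum_fset d) m.
have [f fE] := poly_eval_morphism (fun x : Xv => 'X^(M ^ index x (enum_fset d)) : {poly int}).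
exists f; have md m : m \in msupp a -> (finsupp m `<=` d)%fset.
  by move=> ma; exact: (bigfcup_sup _ ma).
have mM m x : m \in msupp a -> (m x < M)%N.
  move=> ma; rewrite ltnS; apply: leq_trans (leq_bigmax_seq _ ma _) => //.
  have [xm|] := boolP (x \in finsupp m); last by rewrite -cmE_eq0 => /eqP->.
  by rewrite mdegE (big_fsetD1 x) //= leq_addr.
have w_inj m m' : m \in msupp a -> m' \in msupp a -> w m = w m' -> m = m'.
  move=> ma m'a wm; apply/eqP/cmP => x.
  have [xd|xd] := boolP (x \in d).
    by apply: (weight_inj (fset_uniq d) _ wm) xd => y _; rewrite !mM.
  have out n : n \in msupp a -> n x = 0%N.
    by move=> na; apply/eqP; rewrite cmE_eq0; apply: contra xd; apply/fsubsetP/md.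
  by rewrite !out.
have [m0 m0a] : exists m0, m0 \in msupp a.
  by apply/fset0Pn; rewrite msupp_eq0.
have fa : f a = \sum_(m <- msupp a) 'X^(w m) *~ a@_m.
  rewrite fE /poly_eval /linext; apply: eq_big_seq => m ma; congr (_ *~ _).
  rewrite (@monomial_evalw _ _ _ d) ?md // /w /weight expr_sum.
  by apply: eq_bigr => x _; rewrite -exprM mulnC.
have cE k j (c : int) : ('X^k *~ c : {poly int})`_j = (j == k)%:R *~ c.
  by rewrite -[LHS]/(coefp j _) raddfMz /= coefXn.
(* No other monomial has weight [w m0], so this coefficient is the coefficient of [m0] in [a]. *)
have : (f a)`_(w m0) != 0.
  rewrite fa coef_sum (bigD1_seq m0 m0a (fset_uniq _)) /= big_seq_cond big1.
    by rewrite addr0 cE eqxx intz mcoeff_neq0.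
  move=> m /andP[ma mm0]; rewrite cE; case: eqP => [/(w_inj _ _ m0a ma) m0m|]; last by rewrite mul0rz.
  by rewrite m0m eqxx in mm0.
by apply: contraNneq => ->; rewrite coef0.
Qed.

Lemma poly_powI p : odd p -> injective (fun a => a ^+ p).
Proof.
move=> p_odd a b /= ab; apply/eqP; rewrite -subr_eq0; apply: contraT.
move=> /poly_separation[f]; rewrite rmorphB subr_eq0 => /eqP[].
by apply: (poly_int_powI p_odd); rewrite /= -!rmorphXn ab.
Qed.

Lemma malg_torsion_free (K : choiceType) n : (0 < n)%N ->
  forall g : {malg int[K]}, g *+ n = 0 -> g = 0.
Proof.
move=> n0 g gn; apply/malgP => k; rewrite mcoeff0.
have := congr1 (mcoeff k) gn; rewrite mcoeffMn mcoeff0 => /eqP; rewrite mulrn_eq0.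
by rewrite (gtn_eqF n0) => /eqP.
Qed.
End PolynomialPowers.

(** * The presentation of R by Z[R] and its functoriality *)

Section ZRTheory.
Variable R : comPzRingType.

Lemma evalZE (a : ZR R) : evalZ a = linext (monomial_eval id) a.
Proof. by apply: eq_bigr => m _; rewrite mulrzl. Qed.

Fact evalZ_zmod : zmod_morphism (@evalZ R).
Proof. by move=> a b; rewrite !evalZE; exact: linextB. Qed.

Fact evalZ_monoid : monoid_morphism (@evalZ R).
Proof.
have [e1 eM] := linext_monoid_morphism (monomial_evalP (id : R -> R)).
by split=> [|a b]; rewrite !evalZE.
Qed.

Definition evalZ_rmorphism : {rmorphism ZR R -> R} :=
  HB.pack (@evalZ R) (GRing.isZmodMorphism.Build _ _ _ evalZ_zmod)
    (GRing.isMonoidMorphism.Build _ _ _ evalZ_monoid).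

Lemma evalZ_var (x : R) : evalZ (varZ x) = x.
Proof. by rewrite evalZE; exact: (poly_evalU id). Qed.

Lemma evalZ_subP (x y : ZR R) : evalZ (x - y) = 0 <-> evalZ x = evalZ y.
Proof.
by rewrite evalZ_zmod; split=> [/eqP|->]; rewrite ?subrr // subr_eq0 => /eqP.
Qed.

Lemma ZR_powI p : odd p -> injective (fun x : ZR R => x ^+ p).
Proof. exact: poly_powI. Qed.

Lemma ZR_torsion_free p : prime p -> forall x : ZR R, x *+ p = 0 -> x = 0.
Proof. by move=> /prime_gt0; exact: malg_torsion_free. Qed.
End ZRTheory.

Section ZMap.
Variables (R S : comPzRingType) (f : R -> S).

Fact Zmap_zmod : zmod_morphism (Zmap f).
Proof. exact: linextB. Qed.

Fact Zmap_monoid : monoid_morphism (Zmap f).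
Proof. exact: (linext_monoid_morphism (monomial_evalP (fun x => varZ (f x)))). Qed.

Definition Zmap_rmorphism : {rmorphism ZR R -> ZR S} :=
  HB.pack (Zmap f) (GRing.isZmodMorphism.Build _ _ _ Zmap_zmod)
    (GRing.isMonoidMorphism.Build _ _ _ Zmap_monoid).

Lemma Zmap_var x : Zmap f (varZ x) = varZ (f x).
Proof. exact: (poly_evalU (fun x => varZ (f x))). Qed.
End ZMap.

Lemma evalZ_Zmap (R S : comPzRingType) (f : {rmorphism R -> S}) a :
  evalZ (Zmap f a) = f (evalZ a).
Proof.
apply: (poly_rmorphism_eq (f := evalZ_rmorphism S \o Zmap_rmorphism f)
  (g := f \o evalZ_rmorphism R)) => x /=.
rewrite -[<< ucm x >>]/(varZ x) Zmap_var.
by rewrite (evalZ_var (f x)) (evalZ_var x).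
Qed.

Lemma Zmap_id (R : comPzRingType) (f : R -> R) : (forall x, f x = x) -> forall a, Zmap f a = a.
Proof.
move=> fid; apply: (poly_rmorphism_eq (f := Zmap_rmorphism f) (g := idfun)) => x /=.
by rewrite -[<< ucm x >>]/(varZ x) Zmap_var fid.
Qed.

Lemma Zmap_comp (R S T : comPzRingType) (f : R -> S) (g : S -> T) (h : R -> T) :
  (forall x, h x = g (f x)) -> forall a, Zmap h a = Zmap g (Zmap f a).
Proof.
move=> hgf; apply: (poly_rmorphism_eq (f := Zmap_rmorphism h)
  (g := Zmap_rmorphism g \o Zmap_rmorphism f)) => x /=.
by rewrite -[<< ucm x >>]/(varZ x) !Zmap_var hgf.
Qed.

(** As [A] is free on the elements phi(x), sending phi(x) to the variable [phi(x)] splits [evalZ].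
    The endomorphism [e] is evaluation followed by this splitting, so it kills the ideal of
    relations without changing values in [A]. *)
Lemma evalZ_section (Xv : choiceType) (A : comPzRingType)
    (phi : {rmorphism {malg int[{cmonom Xv}]} -> A}) : bijective phi ->
  exists e : {rmorphism ZR A -> ZR A},
    (forall x y, evalZ x = evalZ y -> e x = e y) /\ (forall x, evalZ (e x) = evalZ x).
Proof.
case=> psi phiK psiK.
have psiB : zmod_morphism psi by apply: (can2_zmod_morphism phiK psiK).
have psiM : monoid_morphism psi by apply: (can2_monoid_morphism phiK psiK).
pose psi' : {rmorphism A -> {malg int[{cmonom Xv}]}} :=
  HB.pack psi (GRing.isZmodMorphism.Build _ _ _ psiB) (GRing.isMonoidMorphism.Build _ _ _ psiM).
have [s sE] := poly_eval_morphism (fun x : Xv => varZ (phi << ucm x >>)).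
have evs a : evalZ (s a) = phi a.
  apply: (poly_rmorphism_eq (f := evalZ_rmorphism A \o s) (g := phi)) => x /=.
  by rewrite sE poly_evalU; exact: evalZ_var.
exists (s \o psi' \o evalZ_rmorphism A); split=> [x y /= xy|x /=].
  by congr (s (psi _)); exact: xy.
by rewrite evs; exact: psiK.
Qed.

(** * The groups G and C *)

Section GTheory.
Variables (p : nat) (A : comPzRingType).

Lemma U1S n q : U1 p A n.+1 q -> U1 p A n q.
Proof. by move=> [g /FilS gn ->]; exact: qimgW. Qed.

Lemma W0_complete : complete_filtration (W0 p A).
Proof. exact: completion_complete (@U1S). Qed.

Lemma WG_complete : complete_filtration (WG p A).
Proof. exact: (quot_complete _ W0_complete). Qed.

Lemma toGB : additive_map (@toG p A).
Proof.
move=> g h; rewrite /toG (quotgB (Ht p A)) (compl_embedB (U1 p A)).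
exact: quotgB.
Qed.

Lemma toG_Ht g : Ht p A g -> toG p g = 0.
Proof.
move=> /quotg0 g0; rewrite /toG g0 (amap0 (compl_embedB (U1 p A))).
by rewrite raddf0.
Qed.

Lemma toG_Fil n g : Fil A n g -> WG p A n (toG p g).
Proof. by move=> gn; apply/qimgW/compl_embed_nbhd/qimgW. Qed.

Lemma G_dense n k a : (n <= k)%N -> WG p A n a ->
  exists2 g, Fil A n g & WG p A k (a - toG p g).
Proof.
move=> nk [q qn ->]; have [_ [g gn ->] gk] := compl_dense (@U1S) nk qn.
by exists g => //; rewrite -quotgB; exact: qimgW.
Qed.

Lemma WG0 a : WG p A 0 a.
Proof.
rewrite -(reprK a); apply: qimgW; rewrite -(reprK (repr a)); apply/compl_nbhdP.
by rewrite -(reprK (subT_val _ _)); apply/qimgW/Fil0.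
Qed.

Hypotheses (p_pr : prime p) (p_odd : odd p).
Hypothesis powI : injective (fun x : A => x ^+ p).
Hypothesis tf : forall x : A, x *+ p = 0 -> x = 0.

Lemma U1_divp n q : U1 p A n.+1 (q *+ p) -> U1 p A n q.
Proof.
rewrite -(reprK q) => -[f fn].
rewrite -(raddfMn (\pi_(Q1 p A))) => /quotgP gf.
have [|h hH hn] := @Ht_Fil_divp p A p_pr p_odd powI tf n (repr q).
  exists (repr q *+ p - f) => //; by rewrite subKr.
by exists (repr q - h) => //; apply/quotgP; rewrite subKr.
Qed.

(** Division by p costs one step, so term [n] is controlled through term [n.+1], from which it
    differs by an element of [U1 n]. *)
Lemma G0_torsion_free (x : G0 p A) : x *+ p = 0 -> x = 0.
Proof.
rewrite -(reprK x) -(raddfMn (\pi_(G0 p A))) => /quotg0 px; apply/quotg0 => n.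
have vB : additive_map (fun y : CS (U1 p A) => subT_val y n.+1) by move=> y z; exact: csB.
have : U1 p A n.+1 (subT_val (repr x *+ p) n.+1) := px n.+1.
rewrite (amapMn vB) => /U1_divp xn; change (U1 p A n (subT_val (repr x) n)).
have cx : U1 p A n (subT_val (repr x) n.+1 - subT_val (repr x) n) := subT_valP (repr x) n.
by rewrite -(subKr (subT_val (repr x) n.+1) (subT_val (repr x) n)); exact: sgB.
Qed.

(** There is no p-power torsion to begin with, and separation makes the closure of 0 trivial. Thus G
    and G^0 agree here, and neighbourhoods in G can be read in [Gt A]. *)
Lemma Tcl_trivial x : Tcl p A x -> x = 0.
Proof.
move=> xT; apply: (cfilt_sep W0_complete) => n; have [t tT] := xT n.
suff -> : t = 0 by rewrite subr0.
elim: tT => // [y [k /(pX_torsion_free G0_torsion_free)] //|y z _ -> _ ->].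
exact: subr0.
Qed.

Lemma toG_nbhd n g : WG p A n (toG p g) -> sum_sg (Ht p A) (Fil A n) g.
Proof.
move=> /qimgP[w wn /Tcl_trivial/eqP]; rewrite subr_eq0 => /eqP gw; move: wn.
rewrite -gw => /compl_embed_nbhd/qimgP[f fn gf].
by exists (g - f) => //; rewrite subKr.
Qed.
End GTheory.

Section GOperator.
Variables (p : nat) (A B : comPzRingType) (f : Gt A -> Gt B) (d : nat).
Hypotheses (fB : additive_map f) (fH : forall g, Ht p A g -> Ht p B (f g)).
Hypothesis fd : forall n g, Fil A n g -> Fil B (d + n) (f g).

(** The layers repeat the bodies of [VG] and [Gmap] up to conversion, so that V (with d = 1) and
    functoriality (with d = 0) share one treatment. *)
Definition Qop := qlift (Ht p A) (Ht p B) f.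
Definition G0op := compl_lift (U1 p A) (U1 p B) Qop.
Definition Gop := qlift (Tcl p A) (Tcl p B) G0op.

Let QopB : additive_map Qop. Proof. exact: qliftB. Qed.

Let Qopd n q : U1 p A n q -> U1 p B (d + n) (Qop q).
Proof. by apply: qlift_qimg => //; exact: fd. Qed.

Let Qop0 n q : U1 p A n q -> U1 p B n (Qop q).
Proof. by move=> /Qopd; apply: (filt_le (@U1S p B) (leq_addl _ _)). Qed.

Let G0opB : additive_map G0op. Proof. exact: compl_liftB. Qed.

Let G0opd n q : W0 p A n q -> W0 p B (d + n) (G0op q).
Proof. exact: (compl_lift_shift QopB Qop0 (@U1S p A) Qopd). Qed.

Let G0op0 n q : W0 p A n q -> W0 p B n (G0op q).
Proof. by move=> /G0opd; apply: (filt_le (cfiltS (W0_complete p B)) (leq_addl _ _)). Qed.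

Let G0opT q : Tcl p A q -> Tcl p B (G0op q).
Proof.
apply: (closure_map G0opB G0op0); apply: (gen_map G0opB) => x [k xk]; apply: gen_in; exists k.
by rewrite -(amapMn G0opB) xk (amap0 G0opB).
Qed.

Lemma GopB : additive_map Gop. Proof. exact: qliftB. Qed.

Lemma Gopd n a : WG p A n a -> WG p B (d + n) (Gop a).
Proof. by apply: qlift_qimg => //; exact: G0opd. Qed.

Lemma Gop0 n a : WG p A n a -> WG p B n (Gop a).
Proof. by move=> /Gopd; apply: (filt_le (cfiltS (WG_complete p B)) (leq_addl _ _)). Qed.

Lemma Gop_toG g : Gop (toG p g) = toG p (f g).
Proof.
rewrite /Gop /toG (qlift_pi G0opB G0opT) /G0op (compl_lift_embed QopB Qop0).
by rewrite /Qop (qlift_pi fB fH).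
Qed.
End GOperator.

Section CTheory.
Variables (p : nat) (R : comPzRingType).

Definition J_gen (g : Gt (ZR R)) : Prop :=
  exists n (x y : ZR R), evalZ x = evalZ y /\ g = sym n x - sym n y.
Definition J : subgroup (Gt (ZR R)) := genS J_gen.

Definition WC n : subgroup (C p R) := qimg (GI p R) (WG p (ZR R) n).
Definition toC (g : Gt (ZR R)) : C p R := \pi_(C p R) (toG p g).

Lemma WC_complete : complete_filtration WC.
Proof. exact: (quot_complete _ (WG_complete p (ZR R))). Qed.

Lemma toCB : additive_map toC.
Proof. by move=> g h; rewrite /toC toGB; exact: quotgB. Qed.

Lemma J_toG g : J g -> genS (@GIgen p R) (toG p g).
Proof.
apply: (gen_map (@toGB p (ZR R))) => _ [n [x [y [xy ->]]]]; apply: gen_in.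
by exists n, x, y; split=> //; apply/evalZ_subP.
Qed.

Lemma GI_toG x : genS (@GIgen p R) x -> exists2 g, J g & x = toG p g.
Proof.
elim=> [|_ [n [a [b [ab ->]]]]|_ _ _ [g gJ ->] _ [h hJ ->]].
- by exists 0; [exact: sg0 | rewrite (amap0 (@toGB p (ZR R)))].
- exists (sym n a - sym n b) => //; apply: gen_in; exists n, a, b; split=> //.
  exact/evalZ_subP.
- by exists (g - h); [exact: sgB | rewrite toGB].
Qed.

Lemma toC_J g : J g -> toC g = 0.
Proof.
move=> /J_toG gJ; apply/quotg0 => n; exists (toG p g) => //.
by rewrite subrr; exact: sg0.
Qed.

Lemma toC_Ht g : Ht p (ZR R) g -> toC g = 0.
Proof. by move=> /toG_Ht gH; rewrite /toC gH raddf0. Qed.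

Lemma toC_sym n (x y : ZR R) : evalZ x = evalZ y -> toC (sym n x) = toC (sym n y).
Proof.
move=> xy; apply/eqP; rewrite -subr_eq0 -toCB toC_J //.
by apply: gen_in; exists n, x, y.
Qed.

Lemma toC_Fil n g : Fil (ZR R) n g -> WC n (toC g).
Proof. by move=> gn; apply/qimgW/toG_Fil. Qed.

Lemma C_dense n k a : (n <= k)%N -> WC n a ->
  exists2 g, Fil (ZR R) n g & WC k (a - toC g).
Proof.
move=> nk [b bn ->]; have [g gn gk] := G_dense nk bn.
by exists g => //; rewrite -quotgB; exact: qimgW.
Qed.

Lemma WC0 a : WC 0 a.
Proof. by rewrite -(reprK a); apply/qimgW/WG0. Qed.

Lemma C_approx n a : exists g, WC n (a - toC g).
Proof. by have [g _ gn] := C_dense (leq0n n) (WC0 a); exists g. Qed.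

(** At precision [n] an element of the closure [GI] may be replaced by the image of a genuine
    relation in [J]. What remains is a statement about G, read in [Gt] by [toG_nbhd]. *)
Lemma toC_nbhd : prime p -> odd p -> forall n g,
  WC n (toC g) -> exists2 j, J j & sum_sg (Ht p (ZR R)) (Fil (ZR R) n) (g - j).
Proof.
move=> p_pr p_odd n g /qimgP[w wn /(_ n)[_ /GI_toG[j jJ ->] gwj]]; exists j => //.
apply: (toG_nbhd p_pr p_odd); [exact: ZR_powI|exact: ZR_torsion_free|].
by rewrite toGB; apply/(sgBl _ wn); rewrite addrAC.
Qed.
End CTheory.

Section COperator.
Variables (p : nat) (R S : comPzRingType) (f : Gt (ZR R) -> Gt (ZR S)) (d : nat).
Hypotheses (fB : additive_map f) (fH : forall g, Ht p (ZR R) g -> Ht p (ZR S) (f g)).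
Hypothesis fd : forall n g, Fil (ZR R) n g -> Fil (ZR S) (d + n) (f g).
Hypothesis fJ : forall g, J R g -> J S (f g).

Definition Cop := qlift (GI p R) (GI p S) (@Gop p _ _ f).

Let GopGI a : GI p R a -> GI p S (@Gop p _ _ f a).
Proof.
apply: (closure_map (GopB fB fH fd) (Gop0 fB fH fd)).
move=> x /GI_toG[g gJ ->]; rewrite (Gop_toG fB fH fd); apply/J_toG/fJ/gJ.
Qed.

Lemma CopB : additive_map Cop. Proof. exact: (qliftB (GopB fB fH fd)). Qed.

Lemma Copd n a : WC p R n a -> WC p S (d + n) (Cop a).
Proof. by apply: (qlift_qimg (GopB fB fH fd) GopGI); exact: (Gopd fB fH fd). Qed.

Lemma Cop_toC g : Cop (toC p g) = toC p (f g).
Proof. by rewrite /Cop /toC (qlift_pi (GopB fB fH fd) GopGI) (Gop_toG fB fH fd). Qed.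
End COperator.

(** * C is a weak pre-Witt functor *)

Section CStructure.
Variables (p : nat) (R : comPzRingType).

Lemma Vt_J g : J R g -> J R (Vt g).
Proof.
apply: (gen_map (@VtB (ZR R))) => _ [n [x [y [xy ->]]]]; apply: gen_in.
by exists n.+1, x, y; rewrite (@VtB (ZR R)) !Vt_sym.
Qed.

Let Vt_d n g : Fil (ZR R) n g -> Fil (ZR R) (1 + n) (Vt g) := @Vt_Fil (ZR R) n g.

Lemma C_VB : additive_map (@C_V p R).
Proof. exact: (CopB (@VtB (ZR R)) (@Vt_Ht p (ZR R)) Vt_d Vt_J). Qed.

Lemma C_V_WC n a : WC p R n a -> WC p R n.+1 (C_V p a).
Proof. exact: (Copd (@VtB (ZR R)) (@Vt_Ht p (ZR R)) Vt_d Vt_J). Qed.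

Lemma C_V_toC (g : Gt (ZR R)) : C_V p (toC p g) = toC p (Vt g).
Proof. exact: (Cop_toC (@VtB (ZR R)) (@Vt_Ht p (ZR R)) Vt_d Vt_J). Qed.

Lemma C_V_sym n (r : ZR R) : C_V p (toC p (sym n r)) = toC p (sym n.+1 r).
Proof. by rewrite C_V_toC Vt_sym. Qed.

Lemma iter_C_V_toC n (g : Gt (ZR R)) : iter n (C_V p) (toC p g) = toC p (iter n (@Vt _) g).
Proof. by elim: n => [|n IH]; rewrite ?iterS ?IH ?C_V_toC. Qed.

Lemma iter_C_V_WC m n a : WC p R n a -> WC p R (m + n) (iter m (C_V p) a).
Proof. by move=> an; elim: m => [|m IH]; [exact: an | rewrite iterS addSn; exact: C_V_WC]. Qed.

(** Any polynomial with value x may replace the variable [x]. Identities for <x> are thereby checked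
    with the ring operations of [ZR R], where the relations of [H] apply. *)
Lemma C_br_toC (x : R) (r : ZR R) : evalZ r = x -> C_br p x = toC p (sym 0 r).
Proof. by move=> rx; apply: toC_sym; rewrite evalZ_var. Qed.

Lemma iter_C_V_br n (x : R) (r : ZR R) : evalZ r = x -> iter n (C_V p) (C_br p x) = toC p (sym n r).
Proof. by move=> /C_br_toC->; rewrite iter_C_V_toC iter_Vt_sym addn0. Qed.

(** Combinations of symbols are dense in C, so a continuous additive map into a separated group is
    determined by them. *)
Lemma C_ext (N : zmodType) (U : nat -> subgroup N) (F F' : C p R -> N) :
  complete_filtration U -> additive_map F -> additive_map F' ->
  (forall n a, WC p R n a -> U n (F a)) -> (forall n a, WC p R n a -> U n (F' a)) ->
  (forall n r, F (toC p (sym n r)) = F' (toC p (sym n r))) -> forall a, F a = F' a.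
Proof.
move=> cU FB F'B FU F'U FF' a; apply/eqP; rewrite -subr_eq0; apply/eqP.
apply: (cfilt_sep cU) => n; have [g gn] := C_approx n a.
have -> : F a - F' a = F (a - toC p g) - F' (a - toC p g).
  rewrite FB F'B subr_interchange.
  have -> : F (toC p g) = F' (toC p g); last by rewrite subrr subr0.
  exact: (Gt_eq (amap_comp (@toCB p R) FB) (amap_comp (@toCB p R) F'B) FF').
by apply: sgB; [exact: FU | exact: F'U].
Qed.

(** This identifies the V-adic filtration of C with [WC], for which completeness is known. A
    preimage under V^n is built by successive approximation. *)
Lemma inVnP n (a : C p R) : inVn (D := Cfun p) n a <-> WC p R n a.
Proof.
split=> [[b ->]|an]; first by have := iter_C_V_WC n (WC0 b); rewrite addn0.
have VnB : additive_map (iter n (@C_V p R)) := amap_iter n C_VB.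
(* The function [h] picks the next correction for a remainder known to lie in step [n + k]. The
   value 0 is a filler for other pairs. *)
have /boolp.choice[h hP] (kx : nat * C p R) : exists h, WC p R (n + kx.1) kx.2 ->
    WC p R (n + kx.1).+1 (kx.2 - toC p (iter (n + kx.1) (@Vt _) h)).
  have [xk|] := pselect (WC p R (n + kx.1) kx.2); last by exists 0.
  have [g /Fil_Vt[h ->] gk] := C_dense (leqnSn _) xk.
  by exists h.
(* Adding V^k h to [b] changes V^n b by V^(n+k) h, which improves the remainder by one step. *)
pose t k b := toC p (iter k (@Vt _) (h (k, a - iter n (@C_V p R) b))).
have [b [b0 bS]] : exists b : nat -> C p R, b 0%N = 0 /\ forall k, b k.+1 = b k + t k (b k).
  by exists (fix b k := if k is j.+1 then b j + t j (b j) else 0).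
have bn k : WC p R (n + k) (a - iter n (@C_V p R) (b k)).
  elim: k => [|k IH]; first by rewrite b0 (amap0 VnB) subr0 addn0; exact: an.
  rewrite bS addnS (amapD VnB) opprD addrA /t iter_C_V_toC -iterD.
  exact: (hP (k, _) IH).
have [k|c cb] := cfilt_lim (WC_complete p R) (s := b).
  rewrite bS addrAC subrr add0r; apply: toC_Fil.
  have Fk j g : Fil (ZR R) j (iter j (@Vt _) g).
    by elim: j => [|j IH]; [exact: Fil0 | exact: Vt_Fil].
  exact: Fk.
exists c; apply/eqP; rewrite -subr_eq0; apply/eqP.
apply: (cfilt_sep (WC_complete p R)) => k.
(* The remainder at stage k and V^n of the tail c - b k both lie in step [k]. *)
have -> : a - iter n (@C_V p R) c =
    (a - iter n (@C_V p R) (b k)) - iter n (@C_V p R) (c - b k).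
  by rewrite VnB opprB addrA subrK.
have lift x : WC p R (n + k) x -> WC p R k x.
  exact: (filt_le (cfiltS (WC_complete p R)) (leq_addl n k)).
by apply: sgB; apply: lift; [exact: bn | exact: iter_C_V_WC].
Qed.

Lemma C_Vcomplete : Vcomplete (Cfun p) R.
Proof.
split=> [a an|s Cs].
  by apply: (cfilt_sep (WC_complete p R)) => n; exact/inVnP.
have [n|a aP] := cfilt_lim (WC_complete p R) (s := s); first exact/inVnP.
by exists a => n; exact/inVnP.
Qed.

Lemma C_brN (x : R) : C_br p (- x) = - C_br p x.
Proof.
rewrite (@C_br_toC (- x) (- varZ x)); last first.
  by rewrite -[RHS]/(- x) -{2}(evalZ_var x); exact: (rmorphN (evalZ_rmorphism R)).
apply/eqP; rewrite -addr_eq0 addrC -(amapD (@toCB p R)) toC_Ht //.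
by exists 0%N; apply: gen_in; right; exists 0%N, (varZ x).
Qed.

Lemma C_br0 : C_br p (0 : R) = 0.
Proof.
rewrite (@C_br_toC 0 0); last exact: (rmorph0 (evalZ_rmorphism R)).
by rewrite sym0 (amap0 (@toCB p R)).
Qed.

Lemma C_br_add (x y : R) :
  C_V p (C_br p ((x + y) ^+ p)) - C_br p (x + y) *+ p =
  (C_V p (C_br p (x ^+ p)) - C_br p x *+ p) + (C_V p (C_br p (y ^+ p)) - C_br p y *+ p).
Proof.
have brE (r : ZR R) (u : R) : evalZ r = u ->
    C_V p (C_br p (u ^+ p)) - C_br p u *+ p = toC p (deltaG p 0 r).
  move=> <-; rewrite (@C_br_toC _ (r ^+ p)); last exact: (rmorphXn (evalZ_rmorphism R)).
  by rewrite (@C_br_toC _ r) // C_V_toC Vt_sym -(amapMn (@toCB p R)) -toCB.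
have eD : evalZ (varZ x + varZ y) = x + y.
  by rewrite -[in RHS](evalZ_var x) -[in RHS](evalZ_var y); exact: (rmorphD (evalZ_rmorphism R)).
apply: (etrans (brE _ _ eD)); apply/esym.
apply: (etrans (congr2 +%R (brE _ _ (evalZ_var x)) (brE _ _ (evalZ_var y)))); apply/esym/eqP.
rewrite -(amapD (@toCB p R)) -subr_eq0 -toCB opprD addrA -hrelE toC_Ht //.
by exists 0%N; apply: gen_in; left; exists 1%N, (varZ x), (varZ y).
Qed.
End CStructure.

Section CFunctor.
Variables (p : nat) (R S : comPzRingType) (f : {rmorphism R -> S}).

Lemma Gtmap_Zmap_sym n (r : ZR R) : Gtmap (Zmap f) (sym n r) = sym n (Zmap f r).
Proof. by apply: Gtmap_sym; exact: (rmorph0 (Zmap_rmorphism f)). Qed.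

Let fH g : Ht p (ZR R) g -> Ht p (ZR S) (Gtmap (Zmap f) g) :=
  @Gtmap_Ht p (ZR R) (ZR S) (Zmap_rmorphism f) g.

Let fd n g : Fil (ZR R) n g -> Fil (ZR S) (0 + n) (Gtmap (Zmap f) g).
Proof. by apply: Gtmap_Fil; exact: (rmorph0 (Zmap_rmorphism f)). Qed.

Let fJ g : J R g -> J S (Gtmap (Zmap f) g).
Proof.
apply: (gen_map (GtmapB (Zmap f))) => _ [n [x [y [xy ->]]]]; apply: gen_in.
by exists n, (Zmap f x), (Zmap f y); rewrite GtmapB !Gtmap_Zmap_sym !evalZ_Zmap xy.
Qed.

Lemma C_mapB : additive_map (C_map p f).
Proof. exact: (CopB (GtmapB _) fH fd fJ). Qed.

Lemma C_map_WC n a : WC p R n a -> WC p S n (C_map p f a).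
Proof. exact: (Copd (GtmapB _) fH fd fJ). Qed.

Lemma C_map_toC (g : Gt (ZR R)) : C_map p f (toC p g) = toC p (Gtmap (Zmap f) g).
Proof. exact: (Cop_toC (GtmapB _) fH fd fJ). Qed.

Lemma C_map_sym n (r : ZR R) : C_map p f (toC p (sym n r)) = toC p (sym n (Zmap f r)).
Proof. by rewrite C_map_toC Gtmap_Zmap_sym. Qed.

Lemma C_map_V a : C_map p f (C_V p a) = C_V p (C_map p f a).
Proof.
apply: (C_ext (WC_complete p S) (amap_comp (@C_VB p R) C_mapB) (amap_comp C_mapB (@C_VB p S))).
- by move=> n b /C_V_WC/C_map_WC; exact: (cfiltS (WC_complete p S)).
- by move=> n b /C_map_WC/C_V_WC; exact: (cfiltS (WC_complete p S)).
move=> n r; rewrite /comp; apply: (etrans (congr1 (C_map p f) (C_V_sym p n r))).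
apply: (etrans (C_map_sym n.+1 r)); apply/esym.
by apply: (etrans (congr1 (C_V p) (C_map_sym n r))); exact: C_V_sym.
Qed.

Lemma C_map_br x : C_map p f (C_br p x) = C_br p (f x).
Proof. by apply: (etrans (C_map_sym 0 (varZ x))); rewrite Zmap_var. Qed.
End CFunctor.

Lemma C_is_functor p : is_functor (Cfun p).
Proof.
split=> [R S f|R f fid|R S T f g h hgf|R|]; first exact: C_mapB.
- have fE n (r : ZR R) : C_map p f (toC p (sym n r)) = toC p (sym n r).
    by rewrite C_map_sym Zmap_id.
  exact: (C_ext (F' := @id (C p R)) (WC_complete p R) (@C_mapB p _ _ f) (fun _ _ => erefl)
    (@C_map_WC p R R f) (fun _ _ h => h) fE).
- apply: (C_ext (WC_complete p T) (@C_mapB p _ _ h) (amap_comp (@C_mapB p _ _ f) (@C_mapB p _ _ g))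
    (@C_map_WC p R T h)).
  + by move=> n b /(C_map_WC f)/(C_map_WC g).
  + by move=> n r; rewrite /comp !C_map_sym (Zmap_comp hgf).
- exact: C_VB.
- split=> R S f; [exact: C_map_V | exact: C_map_br].
Qed.

(** * Torsion-freeness of C on polynomial rings *)

Section CTorsion.
Variable p : nat.
Hypotheses (p_pr : prime p) (p_odd : odd p).

(** The endomorphism [e] of [evalZ_section] turns a relation modulo [J] into one without [J], to
    which division by p applies. It does not change classes in C. *)
Lemma C_torsion_free (Xv : choiceType) (A : comPzRingType)
    (phi : {rmorphism {malg int[{cmonom Xv}]} -> A}) : bijective phi ->
  forall a : C p A, a *+ p = 0 -> a = 0.
Proof.
move=> /evalZ_section[e [eJ ee]] a pa; apply: (cfilt_sep (WC_complete p A)) => n.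
(* One extra step of precision pays for the later division by p. *)
have [g gn] := C_approx n.+1 a.
have [j jJ] : exists2 j, J A j & sum_sg (Ht p (ZR A)) (Fil (ZR A) n.+1) (g *+ p - j).
  apply: toC_nbhd => //; rewrite (amapMn (@toCB p A)) -[_ *+ p]opprK; apply: sgN.
  by rewrite -[- _]add0r -pa -mulrnBl; exact: sgMn.
move=> [h hH pgn].
have eB := GtmapB e; have e0 : e 0 = 0 by exact: rmorph0.
have ej : Gtmap e j = 0.
  move: jJ; elim=> [|_ [m [x [y [xy ->]]]]|x y _ ex _ ey]; first exact: (amap0 eB).
    by rewrite eB !Gtmap_sym // (eJ x y) // subrr.
  by rewrite eB ex ey subr0.
have eg : sum_sg (Ht p (ZR A)) (Fil (ZR A) n) (Gtmap e g).
  apply: (Ht_Fil_divp p_pr p_odd (ZR_powI p_odd) (ZR_torsion_free p_pr)).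
  exists (Gtmap e h); first exact: Gtmap_Ht.
  by have := Gtmap_Fil e0 pgn; rewrite !eB ej subr0 (amapMn eB).
have ge : toC p g = toC p (Gtmap e g).
  apply: (Gt_eq (@toCB p A) (amap_comp eB (@toCB p A))) => m r.
  by rewrite /comp (Gtmap_sym e0 m r); apply/toC_sym/esym/ee.
have gn' := cfiltS (WC_complete p A) gn.
rewrite -(subrK (toC p g) a); apply: sgD => //; rewrite ge.
have [h' /toC_Ht h'0 h'n] := eg.
by have := toC_Fil p h'n; rewrite toCB h'0 subr0.
Qed.

Lemma C_weak_pre_Witt : is_weak_pre_Witt p (Cfun p).
Proof.
split=> [|R|R x y|R|Xv A phi]; first exact: C_is_functor.
- by split=> [|x]; [exact: C_br0 | exact: C_brN].
- exact: C_br_add.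
- exact: C_Vcomplete.
- exact: C_torsion_free.
Qed.
End CTorsion.

(** * Universality *)

Section Extension.
Variables (p : nat) (p_pr : prime p) (p_odd : odd p).
Variable D : PWdata.
Variable FF : forall R : comPzRingType, nat -> subgroup (Fo D R).
Hypothesis D_functor : is_functor D.
Hypothesis Fbr0 : forall R : comPzRingType, Fbr D (0 : R) = 0.
Hypothesis FF_complete : forall R, complete_filtration (@FF R).
Hypothesis FF_V : forall R n (a : Fo D R), FF R n a -> FF R n (FV D a).
Hypothesis FF_map : forall (R S : comPzRingType) (f : {rmorphism R -> S}) n (a : Fo D R),
  FF R n a -> FF S n (Fmap D f a).
Hypothesis FF_br : forall (R : comPzRingType) n m (x : R), (n <= m)%N ->
  FF R n (iter m (@FV D R) (Fbr D x)).

Definition theta (R : comPzRingType) : Gt (ZR R) -> Fo D R :=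
  gtext (fun n (r : ZR R) => iter n (@FV D R) (Fbr D (evalZ r))).

Hypothesis theta_Ht : forall (R : comPzRingType) g, Ht p (ZR R) g -> theta g = 0.

Let FVB R : additive_map (@FV D R).
Proof. by case: D_functor => _ _ _ VB _; exact: VB. Qed.

Let FmapB R S f : additive_map (@Fmap D R S f).
Proof. by case: D_functor => mB _ _ _ _; exact: mB. Qed.

Let FmapV (R S : comPzRingType) (f : {rmorphism R -> S}) a : Fmap D f (FV D a) = FV D (Fmap D f a).
Proof. by case: D_functor => _ _ _ _ [mV _]; exact: mV. Qed.

Let Fmap_br (R S : comPzRingType) (f : {rmorphism R -> S}) x : Fmap D f (Fbr D x) = Fbr D (f x).
Proof. by case: D_functor => _ _ _ _ [_ mb]; exact: mb. Qed.

Let thetaB R : additive_map (@theta R). Proof. exact: gtextB. Qed.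

Let theta_sym (R : comPzRingType) n (r : ZR R) :
  theta (sym n r) = iter n (@FV D R) (Fbr D (evalZ r)).
Proof.
rewrite /theta gtext_sym // => m.
have -> : evalZ (0 : ZR R) = 0 by exact: (rmorph0 (evalZ_rmorphism R)).
by rewrite Fbr0 (amap0 (amap_iter m (@FVB R))).
Qed.

Let theta_Fil (R : comPzRingType) n g : Fil (ZR R) n g -> FF R n (theta g).
Proof.
by apply: (gen_map (@thetaB R)) => _ [m [r [nm ->]]]; rewrite theta_sym; exact: FF_br.
Qed.

Let theta_J (R : comPzRingType) g : J R g -> theta g = 0.
Proof.
elim=> [|_ [n [x [y [xy ->]]]]|x y _ gx _ gy]; first exact: (amap0 (@thetaB R)).
  by rewrite thetaB !theta_sym xy subrr.
by rewrite thetaB gx gy subr0.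
Qed.

(** This is the continuity of [theta] for the topology that C induces on [Gt]: both kinds of
    relation are killed, and only the part in [Fil n] survives. *)
Let theta_WC (R : comPzRingType) n g : WC p R n (toC p g) -> FF R n (theta g).
Proof.
move=> /(toC_nbhd p_pr p_odd)[j jJ [h hH /theta_Fil]].
by rewrite !thetaB (theta_J jJ) (theta_Ht hH) !subr0.
Qed.

Let theta_Vt (R : comPzRingType) (g : Gt (ZR R)) : theta (Vt g) = FV D (theta g).
Proof.
apply: (Gt_eq (amap_comp (@VtB (ZR R)) (@thetaB R)) (amap_comp (@thetaB R) (@FVB R))).
by move=> n r; rewrite /comp Vt_sym !theta_sym.
Qed.

Let theta_map (R S : comPzRingType) (f : {rmorphism R -> S}) (g : Gt (ZR R)) :
  theta (Gtmap (Zmap f) g) = Fmap D f (theta g).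
Proof.
apply: (Gt_eq (amap_comp (GtmapB (Zmap f)) (@thetaB S)) (amap_comp (@thetaB R) (@FmapB R S f))).
move=> n r; rewrite /comp Gtmap_Zmap_sym !theta_sym evalZ_Zmap -Fmap_br.
by elim: n => //= n ->; rewrite FmapV.
Qed.

(** This relation is the graph of the continuous extension of [theta] to C. Compatibility with each
    operation then reduces to applying the operation to approximants and invoking uniqueness. *)
Let limit (R : comPzRingType) (a : C p R) (b : Fo D R) :=
  forall n, exists2 g, WC p R n (a - toC p g) & FF R n (b - theta g).

Let limit_unique (R : comPzRingType) (a : C p R) b b' : limit a b -> limit a b' -> b = b'.
Proof.
move=> ab ab'; apply/eqP; rewrite -subr_eq0; apply/eqP.
apply: (cfilt_sep (FF_complete R)) => n; have [g ag bg] := ab n; have [h ah bh] := ab' n.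
have /theta_WC : WC p R n (toC p (g - h)).
  rewrite toCB -(subKr a (toC p g)) -(subKr a (toC p h)) subr_interchange subrr sub0r.
  by apply: sgN; exact: sgB.
rewrite thetaB => gh; have := sgD (sgB bg bh) gh.
by rewrite subr_interchange subrK.
Qed.

Let limit_ex (R : comPzRingType) (a : C p R) : exists b, limit a b.
Proof.
have /boolp.choice[g ag] := fun n => C_approx n a.
have [n|b bg] := cfilt_lim (FF_complete R) (s := fun n => theta (g n)); last first.
  by exists b => n; exists (g n).
rewrite -thetaB; apply: theta_WC; rewrite toCB.
rewrite -(subKr a (toC p (g n.+1))) -(subKr a (toC p (g n))) subr_interchange subrr sub0r.
by apply/sgN/sgB => //; exact: (cfiltS (WC_complete p R)).
Qed.

Lemma C_initial_ex : exists eta, compatible_nt (Cfun p) D eta.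
Proof.
pose eta R (a : C p R) : Fo D R := projT1 (cid (limit_ex a)).
have etaP R (a : C p R) : limit a (eta R a) := projT2 (cid (limit_ex a)).
have etaE R (a : C p R) b : limit a b -> eta R a = b by apply: limit_unique; exact: etaP.
exists eta; split=> [R a b|R S f a|R a|R x]; apply: etaE => n.
- have [g ag eg] := etaP R a n; have [h bh eh] := etaP R b n; exists (g - h).
    by rewrite toCB subr_interchange; exact: sgB.
  by rewrite thetaB subr_interchange; exact: sgB.
- have [g ag eg] := etaP R a n; exists (Gtmap (Zmap f) g).
    by rewrite -C_map_toC -C_mapB; exact: C_map_WC.
  by rewrite theta_map -FmapB; exact: FF_map.
- have [g ag eg] := etaP R a n; exists (Vt g).
    by rewrite -C_V_toC -C_VB; apply: (cfiltS (WC_complete p R)); exact: C_V_WC.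
  by rewrite theta_Vt -FVB; exact: FF_V.
- exists (sym 0 (varZ x)); first by rewrite subrr; exact: sg0.
  by rewrite theta_sym evalZ_var subrr; exact: sg0.
Qed.
End Extension.

(** * Existence and uniqueness of maps to weak pre-Witt functors *)

Section WeakPreWitt.
Variables (p : nat) (D : PWdata).
Hypotheses (p_pr : prime p) (p_odd : odd p) (D_wpw : is_weak_pre_Witt p D).

Let D_functor : is_functor D. Proof. by case: D_wpw. Qed.

Let FVB R : additive_map (@FV D R).
Proof. by case: D_functor => _ _ _ VB _; exact: VB. Qed.

Let VnB R n : additive_map (iter n (@FV D R)) := amap_iter n (@FVB R).

Let FmapB R S f : additive_map (@Fmap D R S f).
Proof. by case: D_functor => mB _ _ _ _; exact: mB. Qed.

Let FmapVn (R S : comPzRingType) (f : {rmorphism R -> S}) n a :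
  Fmap D f (iter n (@FV D R) a) = iter n (@FV D S) (Fmap D f a).
Proof. by case: D_functor => _ _ _ _ [mV _]; elim: n => //= n <-; exact: mV. Qed.

Fact inVn0 R n : inVn n (0 : Fo D R).
Proof. by exists 0; rewrite (amap0 (@VnB R n)). Qed.
Fact inVnB R n (a b : Fo D R) : inVn n a -> inVn n b -> inVn n (a - b).
Proof. by move=> [x ->] [y ->]; exists (x - y); rewrite VnB. Qed.
Definition Vfil R n : subgroup (Fo D R) := Subgroup (@inVn0 R n) (@inVnB R n).

Lemma Vfil_complete R : complete_filtration (Vfil R).
Proof.
case: D_wpw => _ _ _ /(_ R)[sep lim] _; split=> // n _ [b ->].
by exists (FV D b); rewrite iterSr.
Qed.

(** F(R) itself may have p-torsion, which would obstruct killing the saturation. The map is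
    therefore first taken into F(Z[R]), torsion-free by axiom (4'), and then pushed to F(R) along
    [evalZ]. *)
Let theta_Ht (R : comPzRingType) g : Ht p (ZR R) g -> @theta D R g = 0.
Proof.
case: D_wpw => _ br1 br_add _ tf gH.
have br0 (A : comPzRingType) : Fbr D (0 : A) = 0 by have [] := br1 A.
pose th : Gt (ZR R) -> Fo D (ZR R) := gtext (fun n r => iter n (@FV D (ZR R)) (Fbr D r)).
have thB : additive_map th by exact: gtextB.
have th_sym n r : th (sym n r) = iter n (@FV D (ZR R)) (Fbr D r).
  by rewrite /th gtext_sym // => m; rewrite br0 (amap0 (@VnB _ m)).
have th_delta n r : th (deltaG p n r) =
    iter n (@FV D _) (FV D (Fbr D (r ^+ p)) - Fbr D r *+ p).
  by rewrite /deltaG thB (amapMn thB) !th_sym iterSr VnB (amapMn (@VnB _ n)).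
have idb : bijective (idfun : {rmorphism {malg int[{cmonom R}]} -> ZR R}) by exists idfun.
have th0 : th g = 0.
  apply: (Ht_kill thB p_pr (tf _ _ _ idb)) gH; apply: (H_kill thB) => [n x y|n r].
    apply: (etrans (th_delta _ _)); apply/esym.
    apply: (etrans (congr2 +%R (th_delta n x) (th_delta n y))).
    by rewrite -(amapD (@VnB _ n)); congr (iter n _ _); exact/esym/br_add.
  apply: (etrans (th_sym _ _)); apply/esym; apply: (etrans (congr1 -%R (th_sym n r))).
  by rewrite -(amapN (@VnB _ n)); congr (iter n _ _); exact/esym/(br1 (ZR R)).2.
have -> : @theta D R g = Fmap D (evalZ_rmorphism R) (th g).
  apply: (Gt_eq _ (amap_comp thB (@FmapB _ _ (evalZ_rmorphism R)))) => [|n r].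
    exact: gtextB.
  rewrite /comp th_sym FmapVn /theta gtext_sym => [|m].
    by case: D_functor => _ _ _ _ [_ ->].
  have -> : evalZ (0 : ZR R) = 0 by exact: (rmorph0 (evalZ_rmorphism R)).
  by rewrite br0 (amap0 (@VnB _ m)).
by rewrite th0 (amap0 (@FmapB _ _ _)).
Qed.

Lemma weak_pre_Witt_ex : exists eta, compatible_nt (Cfun p) D eta.
Proof.
apply: (C_initial_ex p_pr p_odd (FF := Vfil) D_functor) => //.
- by move=> R; case: D_wpw => _ /(_ R)[].
- exact: Vfil_complete.
- by move=> R n _ [b ->]; exists (FV D b); rewrite -iterS iterSr.
- by move=> R S f n _ [b ->]; exists (Fmap D f b); rewrite FmapVn.
- move=> R n m x nm; exists (iter (m - n) (@FV D R) (Fbr D x)).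
  by rewrite -iterD subnKC.
Qed.

(** A map commuting with V is continuous for the V-adic filtrations, and on C this filtration is
    [WC]. On symbols the value is forced, since V^n_r represents V^n<evalZ r>. *)
Lemma weak_pre_Witt_unique eta1 eta2 :
  compatible_nt (Cfun p) D eta1 -> compatible_nt (Cfun p) D eta2 ->
  forall (R : comPzRingType) (a : Fo (Cfun p) R), eta1 R a = eta2 R a.
Proof.
move=> [B1 m1 V1 b1] [B2 m2 V2 b2] R.
have Vn (eta : forall R, Fo (Cfun p) R -> Fo D R) n (a : C p R) :
    (forall (R : comPzRingType) (a : C p R), eta R (C_V p a) = FV D (eta R a)) ->
    eta R (iter n (C_V p) a) = iter n (@FV D R) (eta R a).
  by move=> Ve; elim: n => [|n IH] //; rewrite !iterS Ve IH.
have cont (eta : forall R, Fo (Cfun p) R -> Fo D R) n (a : C p R) :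
    (forall (R : comPzRingType) (a : C p R), eta R (C_V p a) = FV D (eta R a)) ->
    WC p R n a -> Vfil R n (eta R a).
  by move=> Ve /inVnP[b ->]; exists (eta R b); exact: Vn.
apply: (C_ext (Vfil_complete R) (B1 R) (B2 R)) => [n a|n a|n r].
- exact: cont.
- exact: cont.
have E : toC p (sym n r) = iter n (C_V p) (C_br p (evalZ r)) by exact/esym/iter_C_V_br.
by rewrite E !Vn //; congr (iter n _ _); apply: (etrans (b1 _ _)); exact/esym/b2.
Qed.
End WeakPreWitt.

(** * The functor E *)

Section XTheory.
Variables (p : nat) (B : comPzRingType).

Definition Vang n (b : B) : nat -> B := iter n (VE p (B:=B)) (ang p b).

Lemma VangE n b k : Vang n b k = if (n <= k)%N then b ^+ (p ^ (k - n)) *+ p ^ n else 0.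
Proof.
elim: n k => [|n IH] [|k]; rewrite ?subn0 //.
rewrite -[LHS]/(Vang n b k *+ p) IH ltnS subSS; case: leqP => _; last exact: mul0rn.
by rewrite -mulrnA expnSr.
Qed.

Lemma VEB : additive_map (@VE p B).
Proof.
move=> x y; apply: funext => -[|k]; rewrite /VE; first exact/esym/subr0.
exact: mulrnBl.
Qed.

Lemma VE_Uprod n x : Uprod B n x -> Uprod B n (VE p x).
Proof. by move=> xn [|k] kn //=; rewrite (xn k (ltnW kn)) mul0rn. Qed.

Lemma Xset_Vang n b : Xset p B (Vang n b).
Proof.
move=> N; exists (Vang n b); first by apply: gen_in; exists n, b.
by rewrite subrr; exact: sg0.
Qed.

Lemma Uprod_lim (s : nat -> nat -> B) : (forall n, Uprod B n (s n.+1 - s n)) ->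
  exists a, forall n, Uprod B n (a - s n).
Proof.
(* Coordinate k is constant from s (k+1) onwards. *)
move=> Cs; exists (fun k => s k.+1 k) => n k kn.
have sS m j : (j < m)%N -> s m.+1 j = s m j.
  by move=> jm; apply/eqP; rewrite -subr_eq0; apply/eqP/(Cs m j).
rewrite -[LHS]/(s k.+1 k - s n k) -(subnKC kn); apply/eqP; rewrite subr_eq0 eq_sym.
by elim: (n - k.+1)%N => [|i IH]; rewrite ?addn0 // addnS sS // leq_addr.
Qed.

Lemma UX_complete : complete_filtration (UX p B).
Proof.
split=> [n x xn k kn|x xn|s Cs].
- by apply: xn; exact: ltnW.
- by apply: subT_inj; apply: funext => k; exact: (xn k.+1 k).
have [|a aP] := Uprod_lim (s := fun n => subT_val (s n)).
  by move=> n; rewrite -subT_valB; exact: Cs.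
(* The coordinatewise limit stays in X because X is closed. *)
have [|x xE] := @exists_subT _ (Xset p B) a.
  move=> n; have [g gX gn] := subT_valP (s n) n; exists g => //.
  by rewrite -(subrK (subT_val (s n)) a) -addrA; exact: sgD.
by exists x => n; rewrite /= /UX_pred subT_valB xE; exact: aP.
Qed.
End XTheory.

Section XOperator.
Variables (p : nat) (R S : comPzRingType) (f : (nat -> ZR R) -> (nat -> ZR S)).
Variables (phi : ZR R -> ZR S) (d : nat).
Hypotheses (fB : additive_map f) (fU : forall n x, Uprod _ n x -> Uprod _ n (f x)).
Hypothesis f_Vang : forall n b, f (Vang p n b) = Vang p (d + n) (phi b).
Hypothesis evalZ_phi : forall a b, evalZ a = evalZ b -> evalZ (phi a) = evalZ (phi b).

Definition Xop (x : X p (ZR R)) : X p (ZR S) := insubd (0 : X p (ZR S)) (f (subT_val x)).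
Definition Eop : E p R -> E p S := qlift (XI p R) (XI p S) Xop.

(** Continuity of [f] and its action on the generators V^n<b> keep the image inside the closed
    subgroup X, so the default 0 of [insubd] is never taken. *)
Lemma Xop_val x : subT_val (Xop x) = f (subT_val x).
Proof.
apply: subT_val_insubd; apply: (closure_map fB fU) (subT_valP x).
apply: (gen_map fB) => _ [n [b ->]]; apply: gen_in; exists (d + n)%N, (phi b).
exact: f_Vang.
Qed.

Let XopB : additive_map Xop.
Proof. by move=> x y; apply: subT_inj; rewrite !(Xop_val, subT_valB). Qed.

Let XopU n x : UX p _ n x -> UX p _ n (Xop x).
Proof. by rewrite /= /UX_pred Xop_val; exact: fU. Qed.

Let XopI x : XI p R x -> XI p S (Xop x).
Proof.
apply: (closure_map XopB XopU); apply: (gen_map XopB) => y [n [a [b [ab yE]]]].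
apply: gen_in; exists (d + n)%N, (phi a), (phi b); split.
  exact/evalZ_subP/evalZ_phi/evalZ_subP.
rewrite Xop_val yE fB.
exact: (congr2 (fun u v => u - v) (f_Vang n a) (f_Vang n b)).
Qed.

Lemma EopB : additive_map Eop. Proof. exact: qliftB XopB XopI. Qed.

Lemma Eop_pi x : Eop (\pi_(E p R) x) = \pi_(E p S) (Xop x).
Proof. exact: qlift_pi XopB XopI x. Qed.

Lemma Eop_fil n a : qimg (XI p R) (UX p _ n) a -> qimg (XI p S) (UX p _ n) (Eop a).
Proof. exact: (qlift_qimg XopB XopI (@XopU n)). Qed.
End XOperator.

Section ETheory.
Variables (p : nat) (R : comPzRingType).

Definition EF n : subgroup (E p R) := qimg (XI p R) (UX p (ZR R) n).

Lemma EF_complete : complete_filtration EF.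
Proof. exact: (quot_complete _ (UX_complete p (ZR R))). Qed.

Definition Xang n (r : ZR R) : X p (ZR R) := insubd (0 : X p (ZR R)) (Vang p n r).

Lemma Xang_val n r : subT_val (Xang n r) = Vang p n r.
Proof. by apply: subT_val_insubd; exact: Xset_Vang. Qed.

Lemma pi_Xang n r s : evalZ r = evalZ s -> \pi_(E p R) (Xang n r) = \pi_(E p R) (Xang n s).
Proof.
move=> rs; apply/quotgP => N; exists (Xang n r - Xang n s); last by rewrite subrr; exact: sg0.
apply: gen_in; exists n, r, s; split; first exact/evalZ_subP.
rewrite subT_valB; exact: (congr2 (fun u v => u - v) (Xang_val n r) (Xang_val n s)).
Qed.

Let VE_Vang n (b : ZR R) : VE p (Vang p n b) = Vang p (1 + n) b.
Proof. by []. Qed.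

Let evalZ_id (a b : ZR R) : evalZ a = evalZ b -> evalZ (id a) = evalZ (id b).
Proof. by []. Qed.

Lemma E_VB : additive_map (@E_V p R).
Proof. exact: (EopB (@VEB p (ZR R)) (@VE_Uprod p (ZR R)) VE_Vang evalZ_id). Qed.

Lemma E_V_pi x : E_V p (\pi_(E p R) x) = \pi_(E p R) (Xop (@VE p (ZR R)) x).
Proof. exact: (Eop_pi (@VEB p (ZR R)) (@VE_Uprod p (ZR R)) VE_Vang evalZ_id). Qed.

Lemma E_V_fil n a : EF n a -> EF n (E_V p a).
Proof. exact: (Eop_fil (@VEB p (ZR R)) (@VE_Uprod p (ZR R)) VE_Vang evalZ_id). Qed.

Lemma Xop_VE_val x : subT_val (Xop (@VE p (ZR R)) x : X p (ZR R)) = VE p (subT_val x).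
Proof. exact: (Xop_val (@VEB p (ZR R)) (@VE_Uprod p (ZR R)) VE_Vang). Qed.

Lemma iter_E_V_br n (x : R) (r : ZR R) : evalZ r = x ->
  iter n (E_V p) (E_br p x) = \pi_(E p R) (Xang n r).
Proof.
move=> rx; have -> : iter n (E_V p) (E_br p x) = \pi_(E p R) (Xang n (varZ x)).
  elim: n => [|n IH] //; rewrite iterS IH E_V_pi; congr (\pi _); apply: subT_inj.
  by rewrite Xop_VE_val !Xang_val.
by apply: pi_Xang; rewrite evalZ_var.
Qed.
End ETheory.

Section EFunctor.
Variables (p : nat) (R S : comPzRingType) (f : {rmorphism R -> S}).

Let F (x : nat -> ZR R) : nat -> ZR S := fun k => Zmap f (x k).

Let FB : additive_map F.
Proof. by move=> x y; apply: funext => k; exact: Zmap_zmod. Qed.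

Let FU n x : Uprod _ n x -> Uprod _ n (F x).
Proof. by move=> xn k kn; rewrite /F (xn k kn); exact: (rmorph0 (Zmap_rmorphism f)). Qed.

Let F_Vang n b : F (Vang p n b) = Vang p (0 + n) (Zmap f b).
Proof.
apply: funext => k; rewrite /F !VangE; case: leqP => _; last exact: (rmorph0 (Zmap_rmorphism f)).
by rewrite -(rmorphXn (Zmap_rmorphism f)); exact: (rmorphMn (Zmap_rmorphism f)).
Qed.

Let evalZ_F (a b : ZR R) : evalZ a = evalZ b -> evalZ (Zmap f a) = evalZ (Zmap f b).
Proof. by rewrite !evalZ_Zmap => ->. Qed.

Lemma E_mapB : additive_map (E_map p f).
Proof. exact: (EopB FB FU F_Vang evalZ_F). Qed.

Lemma E_map_fil n a : EF p R n a -> EF p S n (E_map p f a).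
Proof. exact: (Eop_fil FB FU F_Vang evalZ_F). Qed.

Definition X_map : X p (ZR R) -> X p (ZR S) := Xop F.

Lemma X_map_val x k : subT_val (X_map x) k = Zmap f (subT_val x k).
Proof. by rewrite /X_map (Xop_val FB FU F_Vang). Qed.

Lemma E_map_pi x : E_map p f (\pi_(E p R) x) = \pi_(E p S) (X_map x).
Proof. exact: (Eop_pi FB FU F_Vang evalZ_F). Qed.
End EFunctor.

Lemma E_is_functor p : is_functor (Efun p).
Proof.
split=> [R S f|R f fid a|R S T f g h hgf a|R|]; first exact: E_mapB.
- rewrite -(reprK a); apply: (etrans (E_map_pi _ _)); congr (\pi _); apply: subT_inj.
  by apply: funext => k; rewrite X_map_val Zmap_id.
- rewrite -(reprK a); apply: (etrans (E_map_pi _ _)); apply/esym.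
  apply: (etrans (congr1 (E_map p g) (E_map_pi _ _))); apply: (etrans (E_map_pi _ _)).
  congr (\pi _); apply: subT_inj; apply: funext => k.
  by rewrite !X_map_val (Zmap_comp hgf).
- exact: E_VB.
split=> R S f => [a|x].
  rewrite -(reprK a); apply: (etrans (congr1 (E_map p f) (E_V_pi _))).
  apply: (etrans (E_map_pi _ _)); apply/esym.
  apply: (etrans (congr1 (E_V p) (E_map_pi _ _))); apply: (etrans (E_V_pi _)).
  congr (\pi _); apply: subT_inj; apply: funext => k.
  rewrite X_map_val !Xop_VE_val; case: k => [|k] /=.
    exact/esym/(rmorph0 (Zmap_rmorphism f)).
  by rewrite X_map_val; exact/esym/(rmorphMn (Zmap_rmorphism f)).
apply: (etrans (congr1 (E_map p f) (iter_E_V_br p 0 (evalZ_var x)))).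
apply: (etrans (E_map_pi _ _)); apply/esym.
apply: (etrans (iter_E_V_br p 0 (evalZ_var (f x)))).
congr (\pi _); apply: subT_inj; apply: funext => k.
rewrite X_map_val !Xang_val !VangE /= !mulr1n -(Zmap_var f).
exact/esym/(rmorphXn (Zmap_rmorphism f)).
Qed.

Section EUniversal.
Variable p : nat.
Hypotheses (p_pr : prime p) (p_odd : odd p).

Let Xang0 (R : comPzRingType) n : Xang p n (0 : ZR R) = 0.
Proof.
apply: subT_inj; rewrite Xang_val; apply: funext => k; rewrite VangE.
by rewrite expr0n expn_eq0 (gtn_eqF (prime_gt0 p_pr)) mul0rn if_same.
Qed.

(** The coordinates of the lift to X(Z[R]) are the ghost components, which vanish on [Ht]. The
    saturation is thus killed before passing to the quotient E(R). *)
Let theta_Ht (R : comPzRingType) g : Ht p (ZR R) g -> @theta (Efun p) R g = 0.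
Proof.
move=> gH; pose th : Gt (ZR R) -> X p (ZR R) := gtext (Xang p (R:=R)).
have thB : additive_map th by exact: gtextB.
have th_sym n r : th (sym n r) = Xang p n r by exact: gtext_sym.
have th_ghost k h : subT_val (th h) k = ghost p k h.
  have vB : additive_map (fun x : X p (ZR R) => subT_val x k).
    by move=> x y; rewrite subT_valB.
  apply: (Gt_eq (amap_comp thB vB) (@ghostB p (ZR R) k)) => n r.
  by rewrite /comp th_sym Xang_val VangE ghost_sym.
have th0 : th g = 0.
  apply: subT_inj; apply: funext => k; rewrite th_ghost.
  exact: (ghost_Ht p_pr p_odd (ZR_torsion_free p_pr)).
have -> : @theta (Efun p) R g = \pi_(E p R) (th g).
  have piB : additive_map (\pi_(E p R)) by move=> x y; rewrite raddfB.
  apply: (Gt_eq (gtextB _) (amap_comp thB piB)) => n r.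
  rewrite /comp th_sym /theta gtext_sym => [|m]; first exact: iter_E_V_br.
  apply: (etrans (@iter_E_V_br p R m _ 0 erefl)).
  by rewrite Xang0 raddf0.
by rewrite th0 raddf0.
Qed.

Lemma E_ex : exists eta, compatible_nt (Cfun p) (Efun p) eta.
Proof.
apply: (@C_initial_ex p p_pr p_odd (Efun p) (EF p) (E_is_functor p)) => //.
- move=> R; apply: (etrans (@iter_E_V_br p R 0 0 0 _)).
    exact: (rmorph0 (evalZ_rmorphism R)).
  by rewrite Xang0 raddf0.
- exact: EF_complete.
- by move=> R n a; exact: E_V_fil.
- by move=> R S f n a; exact: E_map_fil.
(* The first m coordinates of V^m<x> are zero, which places it in step n for n <= m. *)
- move=> R n m x nm.
  have -> : iter m (@FV (Efun p) R) (Fbr (Efun p) x) = \pi_(E p R) (Xang p m (varZ x)).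
    exact: (iter_E_V_br p m (evalZ_var x)).
  apply: qimgW => k kn; rewrite Xang_val VangE leqNgt (leq_trans kn nm) //.
Qed.
End EUniversal.

Theorem theorem3p6 (p : nat) : prime p -> (p != 2)%N ->
  is_weak_pre_Witt p (Cfun p) /\
  (forall D : PWdata, is_weak_pre_Witt p D ->
     (exists eta, compatible_nt (Cfun p) D eta) /\
     (forall eta1 eta2, compatible_nt (Cfun p) D eta1 -> compatible_nt (Cfun p) D eta2 ->
        forall (R : comPzRingType) (a : Fo (Cfun p) R), eta1 R a = eta2 R a)) /\
  (exists eta, compatible_nt (Cfun p) (Efun p) eta).
Proof.
move=> p_pr p2; have p_odd : odd p by case/even_prime: p_pr p2 => [->|].
split; first exact: C_weak_pre_Witt.
split=> [D Dw|]; last exact: E_ex.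
by split=> [|eta1 eta2]; [exact: (weak_pre_Witt_ex p_pr p_odd) | exact: weak_pre_Witt_unique].
Qed.
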